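(* Let $X$ be an infinite-dimensional Banach space with (norm) separable dual and let $\delta>0$. Then there exists a closed linear subspace $Z\subseteq X$ such that $X/Z$ has a shrinking (Schauder) basis with basis constant not exceeding $1+\delta$ and such that $$\forall\,\epsilon>0\quad Sz\Big(X/Z,\frac{\epsilon}{9}\Big)\geq Sz(X,\epsilon),$$ hence $Sz(X/Z)=Sz(X)$.
   Context: Banach spaces are over the scalar field $\mathbb{R}$ or $\mathbb{C}$; $B_{X^*}$ is the closed unit ball of the dual $X^*$. Szlenk index. For $\epsilon>0$ and a weak$^*$-compact set $K\subseteq X^*$ let $$s_\epsilon(K)=\{x^*\in K : \operatorname{diam}(U\cap K)>\epsilon \text{ for every weak}^*\text{-open } U\ni x^*\}$$ (diameter with respect to the norm). Iterate transfinitely: $s_\epsilon^0(K)=K$, $s_\epsilon^{\xi+1}(K)=s_\epsilon(s_\epsilon^\xi(K))$, and $s_\epsilon^\xi(K)=\bigcap_{\zeta<\xi}s_\epsilon^\zeta(K)$ for $\xi$ a limit ordinal. The $\epsilon$-Szlenk index $Sz(K,\epsilon)$ is the least ordinal $\xi$ with $s_\epsilon^\xi(K)=\emptyset$, if such an ordinal exists; otherwise it is undefined. If $Sz(K,\epsilon)$ is defined for all $\epsilon>0$, then $Sz(K)=\sup_{\epsilon>0}Sz(K,\epsilon)$; otherwise $Sz(K)$ is undefined. For a Banach space $X$ put $Sz(X,\epsilon)=Sz(B_{X^*},\epsilon)$ and $Sz(X)=Sz(B_{X^*})$. (It is known that if $X^*$ is norm separable then $Sz(X)$ is defined.) *)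

(* Defs.v *)
From HB Require Import structures.
From mathcomp Require Import all_boot all_order all_algebra.
From mathcomp Require Import all_classical all_reals all_analysis.
From mathcomp Require Import complex.

Set Implicit Arguments.
Unset Strict Implicit.
Unset Printing Implicit Defensive.

Import Order.TTheory GRing.Theory Num.Theory.
Import numFieldNormedType.Exports.

Local Open Scope classical_set_scope.
Local Open Scope ring_scope.

(* Ordinals are presented by arbitrarily branching trees. [OSup f] is the least
   upper bound of the family [f] (so [OSup] of a family over an empty type is
   zero, and a limit ordinal is the [OSup] of the ordinals below it). Distinct
   trees may present the same ordinal; equality of ordinals is [oeq]. *)
Inductive ord : Type :=
| OZero
| OSucc of ord
| OSup (A : Type) of (A -> ord).

(* [olt_of (ole a) b] is [a < b]: no ordinal is below zero, a < b + 1 iff a <= b,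
   and a < sup f iff a < f i for some i. *)
Fixpoint olt_of (le_a : ord -> Prop) (b : ord) : Prop :=
  match b with
  | OZero => False
  | OSucc b' => le_a b'
  | OSup A f => exists i : A, olt_of le_a (f i)
  end.

(* a + 1 <= b iff a < b, and sup f <= b iff f i <= b for all i. *)
Fixpoint ole (a b : ord) : Prop :=
  match a with
  | OZero => True
  | OSucc a' => olt_of (ole a') b
  | OSup A f => forall i : A, ole (f i) b
  end.

Definition olt (a : ord) : ord -> Prop := olt_of (ole a).

Definition oeq (a b : ord) : Prop := ole a b /\ ole b a.

Lemma olt_of_sub (P Q : ord -> Prop) (b : ord) :
  (forall c, P c -> Q c) -> olt_of P b -> olt_of Q b.
Proof.
by move=> PQ; elim: b => [//|b _ /PQ//|A f IH [i Pi]]; exists i; exact: IH.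
Qed.

Lemma ole_OSup (A : Type) (f : A -> ord) (i : A) (a : ord) :
  ole a (f i) -> ole a (OSup f).
Proof. by elim: a => [//|a _ ai|B g IH gi j]; [exists i|exact: IH]. Qed.

Lemma ole_refl (a : ord) : ole a a.
Proof. by elim: a => [//|//|A f IH] i; exact: (ole_OSup (i := i)). Qed.

Lemma ole_trans (b a c : ord) : ole a b -> ole b c -> ole a c.
Proof.
elim: a b c => [//|a IHa|A f IH] b c /=; last first.
  by move=> fb bc i; exact: IH (fb i) bc.
elim: b => [//|b _ ab|A f IH [i ai] fc]; last exact: IH ai (fc i).
by apply: olt_of_sub => d; exact: IHa.
Qed.

Lemma olt_ole (a b : ord) : olt a b -> ole a b.
Proof.
elim: a b => [//|a IH|A f IH] b /=; first by apply: olt_of_sub => c; exact: IH.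
by move=> fb i; apply: IH; apply: olt_of_sub fb => c; exact.
Qed.

Lemma ole_olt_trans (b a c : ord) : ole a b -> olt b c -> olt a c.
Proof. by move=> ab; apply: olt_of_sub => d; exact: ole_trans. Qed.

Lemma olt_ole_trans (b a c : ord) : olt a b -> ole b c -> olt a c.
Proof. by move=> ab bc; exact: (@ole_trans b (OSucc a)). Qed.

Lemma ole_total (a b : ord) : ole a b \/ olt b a.
Proof.
have olt_total c : (forall d, ole c d \/ olt d c) ->
    forall d, olt c d \/ ole d c.
  move=> cle; elim=> [|d _|A f IH]; [by right|exact: cle|].
  have [[i ci]|nc] := pselect (exists i, olt c (f i)); first by left; exists i.
  by right => i; have [ci|//] := IH i; case: nc; exists i.
elim: a b => [b|a IH b|A f IH b]; [by left|exact: olt_total|].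
have [[i bi]|nb] := pselect (exists i, olt b (f i)); first by right; exists i.
by left => i; have [//|bi] := IH i b; case: nb; exists i.
Qed.

Lemma olt_wf : well_founded olt.
Proof.
move=> a; have := ole_refl a; move: {2}a => b; move: a.
elim: b => [|b IH|A f IH] a ab; constructor=> c ca.
- by have := olt_ole_trans ca ab.
- by apply: IH; exact: (olt_ole_trans ca ab).
- by have [i ci] := olt_ole_trans ca ab; apply: (IH i); exact: olt_ole.
Qed.

Variant scalar_kind := RealScalars | ComplexScalars.

Definition scalars (R : realType) (k : scalar_kind) : numFieldType :=
  match k with
  | RealScalars => R
  | ComplexScalars => R[i]
  end.

Section scalars_theory.
Context {R : realType} {k : scalar_kind}.
Local Notation K := (scalars R k).

Definition reK : K -> R :=
  match k return scalars R k -> R with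
  | RealScalars => id
  | ComplexScalars => @complex.Re R
  end.

Definition toK : R -> K :=
  match k return R -> scalars R k with
  | RealScalars => id
  | ComplexScalars => fun r => (r%:C)%C
  end.

Lemma toKK : cancel toK reK.
Proof. by rewrite /toK /reK; case: k. Qed.

Lemma toK_inj : injective toK.
Proof. exact: can_inj toKK. Qed.

Lemma reKK (x : K) : 0 <= x -> toK (reK x) = x.
Proof.
rewrite /toK /reK; move: x; case: k => //= x x0.
by apply: RRe_real; exact: ger0_real.
Qed.

Lemma toKD x y : toK (x + y) = toK x + toK y.
Proof. by rewrite /toK; case: k => //=; rewrite -rmorphD. Qed.

Lemma toKM x y : toK (x * y) = toK x * toK y.
Proof. by rewrite /toK; case: k => //=; rewrite -rmorphM. Qed.

Lemma toK0 : toK 0 = 0.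
Proof. by rewrite /toK; case: k. Qed.

Lemma toK1 : toK 1 = 1.
Proof. by rewrite /toK; case: k. Qed.

Lemma ler_toK x y : (toK x <= toK y) = (x <= y).
Proof. by rewrite /toK; case: k => //=; rewrite lecR. Qed.

Lemma ltr_toK x y : (toK x < toK y) = (x < y).
Proof. by rewrite /toK; case: k => //=; rewrite ltcR. Qed.

End scalars_theory.

Section real_norm.
Context {R : realType} {k : scalar_kind}.
Local Notation K := (scalars R k).

(* The norm of a normed space over K takes its values in K; [rnorm] is the same
   norm with values in R. *)
Definition rnorm (V : normedModType K) (x : V) : R := reK `|x|.

Context {V : normedModType K}.
Implicit Types x y : V.

Lemma rnormE x : toK (rnorm x) = `|x|.
Proof. by rewrite /rnorm reKK. Qed.

Lemma rnorm_ge0 x : 0 <= rnorm x.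
Proof. by rewrite -(@ler_toK _ k) toK0 rnormE. Qed.

Lemma rnorm0 : rnorm (0 : V) = 0.
Proof. by apply: (@toK_inj R k); rewrite rnormE normr0 toK0. Qed.

Lemma rnorm0_eq0 x : rnorm x = 0 -> x = 0.
Proof. by move=> x0; apply/normr0_eq0; rewrite -rnormE x0 toK0. Qed.

Lemma rnormD x y : rnorm (x + y) <= rnorm x + rnorm y.
Proof. by rewrite -(@ler_toK _ k) toKD !rnormE ler_normD. Qed.

Lemma rnormZ (l : K) x : rnorm (l *: x) = rnorm (l : K^o) * rnorm x.
Proof.
apply: (@toK_inj R k); rewrite toKM !rnormE normrZ; congr (_ * _).
by rewrite /rnorm reKK.
Qed.

Lemma rnormN x : rnorm (- x) = rnorm x.
Proof. by rewrite /rnorm normrN. Qed.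

End real_norm.

Section norm_notions.
Context {R : realType} {k : scalar_kind}.
Local Notation K := (scalars R k).

Definition unit_ball (V : normedModType K) : set V := [set x | `|x| <= 1].
Arguments unit_ball : clear implicits.

Definition opnorm (V W : normedModType K) (f : V -> W) : \bar R :=
  ereal_sup [set (rnorm (f x))%:E | x in unit_ball V].

Definition diam (V : normedModType K) (S : set V) : \bar R :=
  ereal_sup [set (rnorm (p.1 - p.2))%:E | p in S `*` S].

End norm_notions.
Arguments unit_ball {R k} V.


Section dual.
Context {R : realType} {k : scalar_kind}.
Local Notation K := (scalars R k).
Variable V : normedModType K.

Definition dual_pred : {pred V -> K^o} :=
  fun f => `[< linear f /\ continuous f >].

Lemma dual_pred_submod : submod_closed dual_pred.
Proof.
split.
  apply/asboolP; split; last exact: cst_continuous.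
  by move=> a u v /=; rewrite scaler0 addr0.
move=> a f g /asboolP[lf cf] /asboolP[lg cg]; apply/asboolP; split.
  move=> b u v; rewrite /= !fctE lf lg !scalerDr !scalerA.
  by rewrite (mulrC a b) addrACA.
move=> x; apply: cvgD; last exact: cg.
by apply: cvgZr; exact: cf.
Qed.

HB.instance Definition _ :=
  GRing.isSubmodClosed.Build K (V -> K^o) dual_pred dual_pred_submod.

Record dual := Dual { dual_fun :> V -> K^o ; _ : dual_fun \in dual_pred }.

HB.instance Definition _ := [isSub for dual_fun].
HB.instance Definition _ := [Choice of dual by <:].
HB.instance Definition _ := [SubChoice_isSubLmodule of dual by <:].

Lemma dual_linear (f : dual) : linear f.
Proof. by case: f => f /= /asboolP[]. Qed.

Lemma dual_continuous (f : dual) : continuous f.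
Proof. by case: f => f /= /asboolP[]. Qed.

Lemma dual_bounded (f : dual) :
  exists2 M : R, 0 <= M & forall x, rnorm (f x) <= M * rnorm x.
Proof.
pose lf := GRing.isLinear.Build _ _ _ _ _ (@dual_linear f).
pose g : {linear V -> K^o} := HB.pack (f : V -> K^o) lf.
have /linear_boundedP : bounded_near g (nbhs 0).
  by apply: continuous_linear_bounded; exact: dual_continuous.
move=> /pinfty_ex_gt0[M M0 Mf].
exists (reK M) => [|x]; first by rewrite -(@ler_toK _ k) toK0 reKK ltW.
by rewrite -(@ler_toK _ k) toKM !rnormE (reKK (ltW M0)); exact: Mf.
Qed.

Lemma unit_ball0 : unit_ball V 0.
Proof. by rewrite /unit_ball /= normr0. Qed.

Lemma opnorm_ge (f : dual) x :
  unit_ball V x -> ((rnorm (f x))%:E <= opnorm f)%E.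
Proof. by move=> x1; apply: ereal_sup_ubound; exists x. Qed.

Lemma opnorm_fin_num (f : dual) : opnorm f \is a fin_num.
Proof.
apply/fin_numPlt/andP; split.
  apply: (@lt_le_trans _ _ 0%:E); first exact: ltNyr.
  by apply: le_trans (opnorm_ge f unit_ball0); rewrite lee_fin rnorm_ge0.
have [M M0 Mf] := dual_bounded f.
apply: (@le_lt_trans _ _ M%:E); last exact: ltry.
apply: ge_ereal_sup => _ [x x1 <-]; rewrite lee_fin (le_trans (Mf x))//.
by rewrite ler_piMr// -(@ler_toK _ k) rnormE toK1.
Qed.

Definition dual_norm (f : dual) : K := toK (fine (opnorm f)).

Lemma dual_norm_le (f : dual) (M : R) :
  (forall x, unit_ball V x -> rnorm (f x) <= M) -> dual_norm f <= toK M.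
Proof.
move=> Mf; rewrite ler_toK -lee_fin fineK ?opnorm_fin_num//.
by apply: ge_ereal_sup => _ [x x1 <-]; rewrite lee_fin Mf.
Qed.

Lemma dual_norm_ge (f : dual) x :
  unit_ball V x -> rnorm (f x) <= fine (opnorm f).
Proof. by move=> x1; rewrite -lee_fin fineK ?opnorm_fin_num ?opnorm_ge. Qed.

Lemma dual_normD (f g : dual) :
  dual_norm (f + g) <= dual_norm f + dual_norm g.
Proof.
rewrite -toKD; apply: dual_norm_le => x x1.
by rewrite (le_trans (rnormD _ _))// lerD// dual_norm_ge.
Qed.

Lemma dual_normZ (l : K) (f : dual) : dual_norm (l *: f) = `|l| * dual_norm f.
Proof.
have le_normZ (m : K) (g : dual) : dual_norm (m *: g) <= `|m| * dual_norm g.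
  rewrite -(reKK (normr_ge0 m)) -toKM; apply: dual_norm_le => x x1.
  rewrite (_ : (m *: g) x = m *: (g x))// rnormZ ler_wpM2l ?dual_norm_ge//.
  exact: rnorm_ge0.
apply/le_anti; rewrite le_normZ/=.
have [->|l0] := eqVneq l 0.
  rewrite normr0 mul0r /dual_norm -toK0 ler_toK.
  exact: le_trans (rnorm_ge0 _) (dual_norm_ge _ unit_ball0).
rewrite -ler_pdivlMl ?normr_gt0// -normfV -[in leLHS](scalerK l0 f).
exact: le_normZ.
Qed.

Lemma dual_norm0_eq0 (f : dual) : dual_norm f = 0 -> f = 0.
Proof.
rewrite /dual_norm -(@toK0 R k) => /toK_inj f0.
have f1 x : unit_ball V x -> f x = 0.
  move=> /(dual_norm_ge f); rewrite f0 => fx.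
  by apply/rnorm0_eq0/le_anti; rewrite fx rnorm_ge0.
apply/val_inj/funext => x /=.
have [->|x0] := eqVneq x 0; first exact/f1/unit_ball0.
have /f1 : unit_ball V (`|x|^-1 *: x).
  by rewrite /unit_ball /= normrZ normfV normr_id mulVf ?normr_eq0.
have := @dual_linear f `|x|^-1 x 0; rewrite addr0 (f1 0 unit_ball0) addr0 => ->.
by move=> /eqP; rewrite scaler_eq0 invr_eq0 normr_eq0 (negPf x0) => /eqP.
Qed.

HB.instance Definition _ :=
  @Lmodule_isNormed.Build K dual dual_norm dual_normD dual_normZ dual_norm0_eq0.

Lemma dual_normE (f : dual) : (rnorm f)%:E = opnorm f.
Proof. by rewrite /rnorm toKK fineK ?opnorm_fin_num. Qed.

End dual.

Definition weak_star (R : realType) (k : scalar_kind)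
    (V : normedModType (scalars R k)) : Type :=
  initial_topology (fun f : dual V => (f : {ptws V -> (scalars R k)^o})).

HB.instance Definition _ (R : realType) (k : scalar_kind)
    (V : normedModType (scalars R k)) := Topological.copy (weak_star V)
  (initial_topology (fun f : dual V => (f : {ptws V -> (scalars R k)^o}))).

Section quotient.
Context {R : realType} {k : scalar_kind} {V : normedModType (scalars R k)}.
Local Notation K := (scalars R k).
Local Open Scope quotient_scope.

Record closed_subspace := ClosedSubspace {
  subspace_pred :> {pred V} ;
  subspace_submod : submod_closed subspace_pred ;
  subspace_closed : closed [set x : V | x \in subspace_pred] }.

HB.instance Definition _ (Z : closed_subspace) :=
  GRing.isSubmodClosed.Build K V (subspace_pred Z) (subspace_submod Z).

Variable Z : closed_subspace.

Definition quot_space : Type := Quotient.quot (subspace_pred Z).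
Local Notation Q := quot_space.

HB.instance Definition _ := EqQuotient.on Q.
HB.instance Definition _ := Choice.on Q.
HB.instance Definition _ := GRing.Zmodule.on Q.

Definition quot_map (x : V) : Q := \pi_(Quotient.quot (subspace_pred Z)) x.

Lemma quot_map_surj (q : Q) : exists x, quot_map x = q.
Proof. by exists (repr q); rewrite /quot_map reprK. Qed.

Lemma quot_mapP x y : (quot_map x = quot_map y) <-> (x - y \in subspace_pred Z).
Proof.
rewrite /quot_map Quotient.idealrBE; split => [->//|/eqP//].
Qed.

Lemma quot_mapD x y : quot_map (x + y) = quot_map x + quot_map y.
Proof. by rewrite /quot_map raddfD. Qed.

Definition quot_scale (l : K) (q : Q) : Q := quot_map (l *: repr q).

Lemma quot_mapZ l x : quot_map (l *: x) = quot_scale l (quot_map x).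
Proof.
apply/quot_mapP; rewrite -scalerBr rpredZ//; apply/quot_mapP.
by rewrite /quot_map reprK.
Qed.

Lemma quot_scaleA l m q :
  quot_scale l (quot_scale m q) = quot_scale (l * m) q.
Proof.
by have [x <-] := quot_map_surj q; rewrite -!quot_mapZ scalerA.
Qed.

Lemma quot_scale1 : left_id 1 quot_scale.
Proof.
by move=> q; have [x <-] := quot_map_surj q; rewrite -!quot_mapZ scale1r.
Qed.

Lemma quot_scaleDr : right_distributive quot_scale +%R.
Proof.
move=> l p q; have [x <-] := quot_map_surj p; have [y <-] := quot_map_surj q.
by rewrite -quot_mapD -!quot_mapZ -quot_mapD scalerDr.
Qed.

Lemma quot_scaleDl q : {morph quot_scale^~ q : l m / l + m}.
Proof.
move=> l m; have [x <-] := quot_map_surj q.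
by rewrite -!quot_mapZ -quot_mapD scalerDl.
Qed.

HB.instance Definition _ := GRing.Zmodule_isLmodule.Build K Q
  quot_scaleA quot_scale1 quot_scaleDr quot_scaleDl.

Definition quot_rnorm (q : Q) : R :=
  inf [set rnorm x | x in quot_map @^-1` [set q]].

Definition quot_norm (q : Q) : K := toK (quot_rnorm q).

Lemma quot_rnorm_le x : quot_rnorm (quot_map x) <= rnorm x.
Proof.
apply: ge_inf; last by exists x.
by exists 0 => _ [y _ <-]; exact: rnorm_ge0.
Qed.

Lemma quot_rnorm_ge (q : Q) (M : R) :
  (forall x, quot_map x = q -> M <= rnorm x) -> M <= quot_rnorm q.
Proof.
move=> Mq; apply: lb_le_inf; last by move=> _ [x xq <-]; exact: Mq.
by have [x xq] := quot_map_surj q; exists (rnorm x), x.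
Qed.

Lemma quot_normD p q : quot_norm (p + q) <= quot_norm p + quot_norm q.
Proof.
rewrite -toKD ler_toK -lerBlDr; apply: quot_rnorm_ge => x <-.
rewrite lerBlDr -lerBlDl; apply: quot_rnorm_ge => y <-.
by rewrite lerBlDl (le_trans _ (rnormD _ _))// -quot_mapD quot_rnorm_le.
Qed.

Lemma quot_normZ l q : quot_norm (l *: q) = `|l| * quot_norm q.
Proof.
have le_normZ (m : K) (p : Q) : `|m| * quot_norm p <= quot_norm (m *: p).
  rewrite -(reKK (normr_ge0 m)) -toKM ler_toK.
  have [->|m0] := eqVneq m 0.
    rewrite normr0 -(@toK0 R k) toKK mul0r.
    by apply: quot_rnorm_ge => x _; exact: rnorm_ge0.
  apply: quot_rnorm_ge => x xmp.
  have -> : x = m *: (m^-1 *: x) by rewrite scalerA mulfV// scale1r.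
  rewrite rnormZ ler_wpM2l//; first exact: (@rnorm_ge0 _ _ K^o).
  have -> : p = quot_map (m^-1 *: x).
    by rewrite quot_mapZ xmp -[quot_scale _ _]/(m^-1 *: (m *: p)) scalerA
      mulVf// scale1r.
  exact: quot_rnorm_le.
apply/le_anti; rewrite le_normZ andbT.
have [->|l0] := eqVneq l 0.
  rewrite scale0r normr0 mul0r -(@toK0 R k) ler_toK.
  rewrite (le_trans (y := quot_rnorm (quot_map 0)))//; last first.
    by rewrite (le_trans (quot_rnorm_le _))// rnorm0.
  by rewrite /quot_map raddf0.
have := le_normZ l^-1 (l *: q).
by rewrite scalerA mulVf// scale1r normfV ler_pdivrMl ?normr_gt0.
Qed.

Lemma quot_norm0_eq0 q : quot_norm q = 0 -> q = 0.
Proof.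
rewrite /quot_norm -(@toK0 R k) => /toK_inj.
have [x <-] := quot_map_surj q => x0.
suff : quot_map x = quot_map 0 by rewrite /quot_map raddf0.
apply/quot_mapP; rewrite subr0.
apply: (@subspace_closed Z) => /= B.
move=> /nbhs_normP[e /= e0 eB].
have e0' : toK (reK e) = e by rewrite reKK// ltW.
have re0 : 0 < reK e by rewrite -(@ltr_toK _ k) toK0 e0'.
suff [y [yx ye]] : exists y, quot_map y = quot_map x /\ rnorm y < reK e.
  exists (x - y); split => /=; first by apply/quot_mapP.
  apply: eB => /=; rewrite opprB addrC subrK -rnormE.
  by rewrite -e0' ltr_toK.
apply: contrapT => /forallNP ny.
have : reK e <= quot_rnorm (quot_map x).
  apply: quot_rnorm_ge => y yx; rewrite leNgt; apply/negP => ye.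
  exact: (ny y).
by rewrite x0 leNgt re0.
Qed.

HB.instance Definition _ :=
  @Lmodule_isNormed.Build K Q quot_norm quot_normD quot_normZ quot_norm0_eq0.

End quotient.
Arguments closed_subspace {R k} V.

Section szlenk.
Context {R : realType} {k : scalar_kind} {V : normedModType (scalars R k)}.
Implicit Types (K : set (dual V)) (eps : R).

Definition szlenk_derivation eps K : set (dual V) :=
  [set f | K f /\ forall U : set (weak_star V),
    open U -> U f -> (eps%:E < diam (U `&` K))%E].

(* Intersecting with [K] only matters for the supremum of an empty family. *)
Fixpoint szlenk_iter eps K (a : ord) : set (dual V) :=
  match a with
  | OZero => K
  | OSucc b => szlenk_derivation eps (szlenk_iter eps K b)
  | OSup A f => K `&` \bigcap_(i in [set: A]) szlenk_iter eps K (f i)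
  end.

Lemma diam_sub (S T : set (dual V)) : S `<=` T -> (diam S <= diam T)%E.
Proof.
by move=> ST; apply: ereal_sup_le; apply: image_subset => p [p1 p2]; split;
  exact: ST.
Qed.

Lemma szlenk_derivation_sub eps K L : K `<=` L ->
  szlenk_derivation eps K `<=` szlenk_derivation eps L.
Proof.
move=> KL f [Kf fK]; split=> [|U oU Uf]; first exact: KL.
by apply: lt_le_trans (fK U oU Uf) _; apply: diam_sub; exact: setIS.
Qed.

(* In particular [szlenk_iter eps K a] depends on [a] only up to [oeq]. *)
Lemma szlenk_iter_ole eps K (a b : ord) : ole a b ->
  szlenk_iter eps K b `<=` szlenk_iter eps K a.
Proof.
have iter0 c : szlenk_iter eps K c `<=` K.
  by elim: c => [//|c IH x [/IH]//|A f _ x []].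
elim: a b => [b _|a IH b|A f IH b fb x bx]; first exact: iter0.
  elim: b => [//|b _ ab|A f IHb [i /IHb ab] x [_ /(_ i I)/ab]//].
  by apply: szlenk_derivation_sub; exact: IH.
by split=> [|i _]; [exact: iter0 bx|exact: IH (fb i) _ bx].
Qed.

(* [a] is Sz(K, eps); there is no such [a] when Sz(K, eps) is undefined. *)
Definition is_Szlenk_eps K eps (a : ord) : Prop :=
  szlenk_iter eps K a = set0 /\
  forall b, szlenk_iter eps K b = set0 -> ole a b.

(* [a] is Sz(K). *)
Definition is_Szlenk K (a : ord) : Prop :=
  exists f : {posnum R} -> ord,
    (forall e : {posnum R}, is_Szlenk_eps K e%:num (f e)) /\ oeq a (OSup f).

End szlenk.

Section bases.
Context {R : realType} {k : scalar_kind} {V : normedModType (scalars R k)}.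
Local Notation K := (scalars R k).
Implicit Types (e : V ^nat) (x : V).

Definition is_expansion e x (a : K ^nat) : Prop :=
  series (fun n => a n *: e n) @ \oo --> x.

Definition schauder_basis e : Prop := forall x, exists! a, is_expansion e x a.

Definition basis_coef e x : K ^nat := xget (cst 0) [set a | is_expansion e x a].

Definition basis_proj e (n : nat) x : V :=
  \sum_(i < n) basis_coef e x i *: e i.

Definition basis_constant e : \bar R :=
  ereal_sup (range (fun n => opnorm (basis_proj e n))).

(* The closed linear span of the coordinate functionals is the whole dual. *)
Definition shrinking e : Prop :=
  exists es : (dual V) ^nat, (forall n x, es n x = basis_coef e x n) /\
    dense [set f : dual V |
      exists (n : nat) (c : K ^nat), f = \sum_(i < n) c i *: es i].

End bases.

Definition finite_dimensional (K : numFieldType) (V : lmodType K) : Prop :=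
  exists (n : nat) (b : 'I_n -> V), forall x : V,
  exists c : 'I_n -> K, x = \sum_(i < n) c i *: b i.

Definition separable_space (T : topologicalType) : Prop :=
  exists D : set T, countable D /\ dense D.

(* Main.v *)
Require Import Defs.
From HB Require Import structures.
From mathcomp Require Import all_boot all_order all_algebra.
From mathcomp Require Import all_classical all_reals all_analysis.
From mathcomp Require Import complex ring lra.

Set Implicit Arguments.
Unset Strict Implicit.
Unset Printing Implicit Defensive.

Import Order.TTheory GRing.Theory Num.Theory.
Import numFieldNormedType.Exports.

Local Open Scope classical_set_scope.
Local Open Scope ring_scope.

(** Functionals on [X / Z] are the functionals on [X] that vanish on [Z], with the
    same norm and the same weak* topology. The task is thus to find a sequence
    [g n] of functionals on [X] such that, for [Z] the common kernel of the [g n],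
    the annihilator of [Z] has the [g n] as coordinate functionals of a shrinking
    basis of [X / Z] and still contains enough of every tree of functionals that
    witnesses that an iterated derived set of the dual ball is nonempty.

    Choose the [g n] one after the other, together with increasing
    finite-dimensional subspaces [W n] of [X] such that [g n] vanishes on [W n]
    while [W n.+1] norms, up to the factor [1 + delta], the distances from the span
    of [g 0, ..., g n] to [0, h 0, ..., h n], where [h] is a fixed dense sequence of
    functionals ([norming_tower]). Let [P n] be the partial sum operators given by
    the [g i] and a biorthogonal sequence [e i]. They are the identity on [W n]
    modulo [Z], so that for [f] in the annihilator of [Z] the functionals [f] and
    [f \o P n] agree on [W n]. Norming then bounds the distance from [f \o P n] to
    [h j] by [1 + delta] times the distance from [f] to [h j]
    ([adjoint_distance]). With [0] in place of [h j] this is the bound on the basis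
    constant; with [h j] close to [f] it says that [f \o P n] tends to [f] in norm,
    so that the basis is shrinking. The union of the [W n] is dense because it norms
    a dense set of functionals ([tower_dense]). Finite biorthogonal systems
    in [X] and its dual carry out the bookkeeping: each is a finite-rank projection,
    and it can be enlarged to fix a given vector or functional, or to norm the
    functionals that it fixes ([extend_norming]).

    Since the tower leaves the choice of [g n] free up to a small perturbation
    ([norming_tower_exists]), the [g n] can be the increments of trees. If [f] lies
    in the derived set of [L] for [eps], some [f'] in [L] is at distance more than
    [eps / 2] from [f] and as close to it weak* as desired; [f' - f], corrected to
    vanish on the current system, is a possible next functional. Along a branch these
    increments add up to functionals in the annihilator of [Z], of norm at most [3]
    and with jumps larger than [3 / 8 * eps]. Infinitely many children of a node
    converge weak* to it, so induction on the ordinal places a third of each sum in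
    the derived set of the same order for [eps / 8] ([node_szlenk]). Only countably
    many tasks have to be scheduled: the values of [eps] may be restricted to a
    countable dense set, which costs the difference between [8] and [9], and for
    each of them there are countably many iterates of the derivation
    ([szlenk_iter_countable]), since the dual is separable.

    The Szlenk indices exist because a nonempty bounded weak* closed set is never
    fixed by the derivation ([szlenk_derivation_proper]). That the index of the
    quotient does not exceed that of [X] follows by pulling functionals back
    ([szlenk_iter_pull]). *)

(** * Real-valued norms and functionals *)

Section scalars_and_norms.
Context {R : realType} {k : scalar_kind}.
Local Notation K := (scalars R k).

Lemma toKB (x y : R) : toK (x - y) = toK x - toK y :> K.
Proof.
by apply: (addIr (toK y)); rewrite -toKD !subrK.
Qed.

Lemma rnorm_toK (r : R) : rnorm (toK r : K^o) = `|r|.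
Proof.
apply: (@toK_inj R k); rewrite rnormE; have [r0|r0] := ger0P r.
  by rewrite ger0_norm// -(@toK0 R k) ler_toK.
have -> : toK (- r) = - toK r :> K by rewrite -sub0r toKB toK0 sub0r.
by rewrite ltr0_norm// -(@toK0 R k) ltr_toK.
Qed.

Lemma rnormM (c d : K^o) : rnorm (c * d) = rnorm c * rnorm d.
Proof. exact: (@rnormZ R k K^o). Qed.

Context {V : normedModType K}.
Implicit Types x y : V.

Lemma rnorm_distC x y : rnorm (x - y) = rnorm (y - x).
Proof. by rewrite -rnormN opprB. Qed.

Lemma rnorm_gt0 x : (0 < rnorm x) = (x != 0).
Proof.
rewrite lt_neqAle rnorm_ge0 andbT eq_sym.
by congr (~~ _); apply/eqP/eqP => [/rnorm0_eq0//|->]; rewrite rnorm0.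
Qed.

Lemma rnorm_le0 x : rnorm x <= 0 -> x = 0.
Proof. by move=> x0; apply/rnorm0_eq0/le_anti; rewrite x0 rnorm_ge0. Qed.

Lemma rnorm_distD y x z : rnorm (x - z) <= rnorm (x - y) + rnorm (y - z).
Proof. by rewrite (le_trans _ (rnormD _ _))// addrA subrK. Qed.

Lemma rnormB_ge x y : rnorm x - rnorm y <= rnorm (x - y).
Proof. by rewrite lerBlDr (le_trans _ (rnormD _ _))// subrK. Qed.

Lemma unit_ballE x : unit_ball V x <-> rnorm x <= 1.
Proof. by rewrite /unit_ball /= -rnormE -(@toK1 R k) ler_toK. Qed.

Lemma rnormZ_inv x : x != 0 -> rnorm (toK (rnorm x)^-1 *: x) = 1.
Proof.
rewrite -rnorm_gt0 => x0; rewrite rnormZ rnorm_toK ger0_norm ?mulVf ?gt_eqF//.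
by rewrite invr_ge0 ltW.
Qed.

Lemma toK_gt0 (r : R) : (0 < toK r :> K) = (0 < r).
Proof. by rewrite -(@toK0 R k) ltr_toK. Qed.

Definition ndist x y : R := rnorm (x - y).

Lemma ndistC x y : ndist x y = ndist y x.
Proof. exact: rnorm_distC. Qed.

Lemma ndist_triangle y x z : ndist x z <= ndist x y + ndist y z.
Proof. exact: rnorm_distD. Qed.

Lemma ndistxx x : ndist x x = 0.
Proof. by rewrite /ndist subrr rnorm0. Qed.

Lemma ndistx0 x : ndist x 0 = rnorm x.
Proof. by rewrite /ndist subr0. Qed.

Lemma rnorm_le_ndist y x : rnorm x <= ndist x y + rnorm y.
Proof. by rewrite -(ndistx0 x) -(ndistx0 y) ndist_triangle. Qed.

Lemma nbhs_rnormP x (A : set V) :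
  nbhs x A <-> exists2 e : R, 0 < e & forall y, rnorm (x - y) < e -> A y.
Proof.
split=> [/nbhs_normP[e /= e0 eA]|[e e0 eA]].
  have ee : toK (reK e) = e by rewrite reKK// ltW.
  exists (reK e) => [|y]; first by rewrite -toK_gt0 ee.
  by rewrite -(@ltr_toK _ k) ee rnormE => xy; exact: eA.
apply/nbhs_normP; exists (toK e) => [|y /=]; first by rewrite /= toK_gt0.
by rewrite -rnormE ltr_toK => /eA.
Qed.

Lemma cvg_rnormP (T : Type) (F : set_system T) {FF : Filter F} (f : T -> V) x :
  f @ F --> x <-> forall e : R, 0 < e -> \forall t \near F, rnorm (x - f t) < e.
Proof.
split=> [fx e e0|fx].
  by apply: (fx [set y | rnorm (x - y) < e]); apply/nbhs_rnormP; exists e.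
by move=> A /nbhs_rnormP[e e0 eA]; apply: filterS (fx e e0) => t /eA.
Qed.

Lemma cvg_seq_rnormP (f : V ^nat) x :
  f @ \oo --> x <->
  forall e : R, 0 < e -> exists N, forall n, (N <= n)%N -> rnorm (x - f n) < e.
Proof.
split=> [/cvg_rnormP fx e /fx[N _ Nf]|fx].
  by exists N => n Nn; exact: Nf.
by apply/cvg_rnormP => e /fx[N Nf]; exists N.
Qed.

Lemma cvg_seq_ndistP (f : V ^nat) x :
  f @ \oo --> x <->
  forall e : R, 0 < e -> exists N, forall n, (N <= n)%N -> ndist x (f n) < e.
Proof. exact: cvg_seq_rnormP. Qed.

Lemma closed_rnormP (A : set V) : closed A <->
  forall x, (forall e : R, 0 < e -> exists2 y, A y & rnorm (x - y) < e) -> A x.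
Proof.
split=> [cA x xA|Ax x xA].
  have clx : closure A x.
    move=> B /nbhs_rnormP[e e0 eB]; have [y Ay xy] := xA e e0.
    by exists y; split=> //; exact: eB.
  exact: cA clx.
apply: Ax => e e0.
have [] := xA [set y | rnorm (x - y) < e].
  by apply/nbhs_rnormP; exists e.
by move=> y [Ay xy]; exists y.
Qed.

Lemma dense_rnormP (A : set V) : dense A <->
  forall x (e : R), 0 < e -> exists2 y, A y & rnorm (x - y) < e.
Proof.
split=> [dA x e e0|dA O [x Ox] oO].
  have : nbhs x [set y | rnorm (x - y) < e] by apply/nbhs_rnormP; exists e.
  rewrite nbhsE => -[U [oU Ux] Ue].
  by have [y [Uy Ay]] := dA U (ex_intro _ x Ux) oU; exists y => //; exact: Ue.
have /nbhs_rnormP[e e0 eO] : nbhs x O by exact: open_nbhs_nbhs.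
by have [y Ay /eO Oy] := dA x e e0; exists y.
Qed.

End scalars_and_norms.

Section functionals.
Context {R : realType} {k : scalar_kind}.
Local Notation K := (scalars R k).
Context {V : normedModType K}.
Implicit Types (f g : dual V) (x : V).

HB.instance Definition _ f :=
  GRing.isLinear.Build K V K^o *:%R (dual_fun f) (dual_linear f).

Lemma dual_eqP f g : (forall x, f x = g x) -> f = g.
Proof. by move=> fg; apply/val_inj/funext. Qed.

Lemma dual_funZ f (c : K) x : f (c *: x) = c * f x.
Proof. by rewrite linearZ. Qed.

Lemma dual_fun0 f : f 0 = 0.
Proof. exact: linear0. Qed.

Lemma dual_funD f x y : f (x + y) = f x + f y.
Proof. exact: linearD. Qed.

Lemma dual_funB f x y : f (x - y) = f x - f y.
Proof. exact: linearB. Qed.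

Lemma dual_fun_sum f (I : Type) (s : seq I) (P : pred I) (F : I -> V) :
  f (\sum_(i <- s | P i) F i) = \sum_(i <- s | P i) f (F i).
Proof. exact: linear_sum. Qed.

Lemma dual_sumE (I : Type) (s : seq I) (P : pred I) (F : I -> dual V) x :
  (\sum_(i <- s | P i) F i) x = \sum_(i <- s | P i) F i x.
Proof. by elim/big_ind2 : _ => [//|f a g b <- <-//|//]. Qed.

Lemma dual_norm_ball f x : rnorm x <= 1 -> rnorm (f x) <= rnorm f.
Proof. by move=> x1; rewrite -lee_fin dual_normE opnorm_ge//; apply/unit_ballE. Qed.

Lemma dual_norm_bound f x : rnorm (f x) <= rnorm f * rnorm x.
Proof.
have [->|x0] := eqVneq x 0; first by rewrite linear0 !rnorm0 mulr0.
have /= := @dual_norm_ball f (toK (rnorm x)^-1 *: x).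
rewrite rnormZ_inv// => /(_ (lexx _)).
rewrite dual_funZ rnormM rnorm_toK ger0_norm ?invr_ge0 ?rnorm_ge0//.
by rewrite ler_pdivrMl ?rnorm_gt0// mulrC.
Qed.

Lemma dual_ndist_bound f g x : ndist (f x : K^o) (g x) <= ndist f g * rnorm x.
Proof. exact: (dual_norm_bound (f - g)). Qed.

Lemma dual_ndist_ball f g x : rnorm x <= 1 -> ndist (f x : K^o) (g x) <= ndist f g.
Proof. exact: (@dual_norm_ball (f - g)). Qed.

Lemma dual_norm_ub f (M : R) :
  (forall x, rnorm x <= 1 -> rnorm (f x) <= M) -> rnorm f <= M.
Proof.
move=> fM; rewrite -lee_fin dual_normE; apply: ge_ereal_sup => _ [x x1 <-].
by rewrite lee_fin fM//; apply/unit_ballE.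
Qed.

Lemma dual_norm_near f (e : R) : 0 < e ->
  exists2 x, rnorm x <= 1 & rnorm f - e < rnorm (f x).
Proof.
move=> e0; apply: contrapT => H.
suff : rnorm f <= rnorm f - e by rewrite lerDl oppr_ge0 leNgt e0.
apply: dual_norm_ub => x x1; rewrite leNgt; apply/negP => fx.
by apply: H; exists x.
Qed.

Lemma bounded_dual (h : V -> K^o) (M : R) : linear h ->
  (forall x, rnorm (h x) <= M * rnorm x) -> exists f, forall x, f x = h x.
Proof.
move=> lh hM.
have hB x y : h x - h y = h (x - y).
  by rewrite addrC -scaleN1r -lh scaleN1r addrC.
suff hd : h \in @dual_pred R k V by exists (Dual hd).
apply/asboolP; split=> // x; apply/cvg_rnormP => e e0.
apply/nbhs_rnormP; exists (e / (`|M| + 1)) => [|y].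
  by rewrite divr_gt0// ltr_pwDr.
rewrite ltr_pdivlMr ?ltr_pwDr// => xy.
rewrite hB (le_lt_trans (hM _))// (le_lt_trans _ xy)// mulrC.
by rewrite ler_wpM2l ?rnorm_ge0// (le_trans (ler_norm M))// lerDl.
Qed.

Lemma dual_neq0 f : f != 0 -> exists x, f x = 1.
Proof.
move=> f0; have [x fx] : exists x, f x != 0.
  apply: contrapT => H; move/eqP: f0; apply; apply: dual_eqP => x.
  by apply/eqP; rewrite -[_ == _]negbK; apply/negP => fx; apply: H; exists x.
by exists ((f x)^-1 *: x); rewrite dual_funZ mulVf.
Qed.

(** ** Neighbourhoods and convergence in the weak* topology *)

Lemma weak_star_nbhs f (vs : seq V) (e : R) : 0 < e ->
  nbhs (f : weak_star V) [set g : weak_star V |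
    forall v, v \in vs -> rnorm ((g : dual V) v - f v) < e].
Proof.
move=> e0; elim: vs => [|v vs IH].
  by apply: filterS filterT => g _ w; rewrite in_nil.
have nv : nbhs (f : weak_star V) [set g : weak_star V |
    rnorm ((g : dual V) v - f v) < e].
  have ec : {for (f : weak_star V),
      continuous (fun g : weak_star V => (g : dual V) v : K^o)}.
    apply: (@continuous_comp (weak_star V) {ptws V -> K^o} K^o
      (fun g : weak_star V => (g : dual V) : {ptws V -> K^o})
      (fun h : {ptws V -> K^o} => h v)).
      exact: initial_continuous.
    exact: (@proj_continuous V (fun=> K^o) v).
  have /cvg_rnormP/(_ e e0) := ec.
  by apply: filterS => g /=; rewrite rnorm_distC.
apply: filterS (filterI nv IH) => g [gv gvs] w; rewrite inE => /orP[/eqP->//|].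
exact: gvs.
Qed.

(** The basic neighbourhoods of [f] generate a filter that converges pointwise
    to [f], hence in the product topology. *)
Lemma weak_star_basis (U : set (weak_star V)) f : open U -> U f ->
  exists vs : seq V, exists2 e : R, 0 < e &
    forall g, (forall v, v \in vs -> rnorm (g v - f v) < e) -> U g.
Proof.
move=> oU Uf.
pose B (p : seq V * R) : set (weak_star V) :=
  [set g | forall v, v \in p.1 -> rnorm ((g : dual V) v - f v) < p.2].
pose F := filter_from [set p : seq V * R | 0 < p.2] B.
have FF : Filter F.
  apply: filter_from_filter; first by exists ([::], 1) => /=; exact: ltr01.
  move=> [vs e] [ws d] /= e0 d0; exists (vs ++ ws, Num.min e d).
    by rewrite /= lt_min e0.
  move=> g gvw; split=> v /= vin.
    have := gvw v; rewrite /= mem_cat vin lt_min => /(_ isT).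
    by move=> /andP[].
  have := gvw v; rewrite /= mem_cat vin orbT lt_min => /(_ isT).
  by move=> /andP[].
have Ff : {ptws, (fun g : weak_star V => (g : dual V) : V -> K^o) @ F
    --> (f : V -> K^o)}.
  apply/pointwise_cvgP => x; apply/cvg_rnormP => e e0.
  exists ([:: x], e) => // g gx /=; rewrite rnorm_distC.
  by apply: gx; rewrite inE.
have [C oC CU] := oU.
have nC : nbhs ((f : V -> K^o) : {ptws V -> K^o}) C.
  by apply: open_nbhs_nbhs; split => //; rewrite -CU in Uf.
have [[vs e] e0 BC] := Ff C nC.
by exists vs, e => // g gvs; rewrite -CU; exact: BC.
Qed.

End functionals.

(** * The scalar field: completeness and total boundedness *)

Section scalar_field.
Context {R : realType} {k : scalar_kind}.
Local Notation K := (scalars R k).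

Lemma rnorm_real (x : scalars R RealScalars) : rnorm (x : _^o) = `|x|.
Proof. by []. Qed.

Lemma rnorm_Re (z : scalars R ComplexScalars) : `|complex.Re z| <= rnorm (z : _^o).
Proof. by rewrite -(@ler_toK R ComplexScalars) rnormE; exact: normc_ge_Re. Qed.

Lemma rnorm_imaginary : rnorm (('i%C : scalars R ComplexScalars) : _^o) = 1.
Proof.
by rewrite /rnorm [reK _]/(complex.Re `|'i%C|) normc_def /= expr0n expr1n add0r sqrtr1.
Qed.

Lemma rnormM_complex (z w : R[i]) :
  rnorm (z * w : (scalars R ComplexScalars)^o) =
  rnorm (z : (scalars R ComplexScalars)^o) * rnorm (w : (scalars R ComplexScalars)^o).
Proof. exact: (@rnormM R ComplexScalars z w). Qed.

Lemma rnorm_Im (z : scalars R ComplexScalars) : `|complex.Im z| <= rnorm (z : _^o).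
Proof.
have := rnorm_Re ((z : R[i]) * 'i%C).
by rewrite ReiNIm normrN rnormM_complex rnorm_imaginary mulr1.
Qed.

Lemma rnorm_complex_le (z : scalars R ComplexScalars) :
  rnorm (z : _^o) <= `|complex.Re z| + `|complex.Im z|.
Proof.
rewrite [in leLHS](complexE z); apply: le_trans (rnormD _ _) _.
have normC (r : R) : rnorm ((r%:C)%C : (scalars R ComplexScalars)^o) = `|r|.
  exact: (@rnorm_toK R ComplexScalars).
by rewrite normC lerD2l rnormM_complex rnorm_imaginary mul1r normC.
Qed.

Lemma real_net (M e : R) : 0 < e ->
  exists s : seq R, forall c, `|c| <= M -> exists2 d, d \in s & `|c - d| < e.
Proof.
move=> e0; pose L := (Num.truncn (2 * M / e)).+1.
exists [seq - M + e * i%:R | i <- iota 0 L] => c; rewrite ler_norml => /andP[Mc cM].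
have c0 : 0 <= (c + M) / e by rewrite divr_ge0 ?(ltW e0)// -lerBlDr sub0r.
have /andP[i1 i2] := truncn_itv c0.
exists (- M + e * (Num.truncn ((c + M) / e))%:R).
  apply/mapP; exists (Num.truncn ((c + M) / e)) => //.
  rewrite mem_iota add0n /= ltnS.
  by apply: le_truncn; rewrite ler_pM2r ?invr_gt0//; lra.
rewrite ger0_norm.
  by move: i2; rewrite ltr_pdivrMr// -natr1; lra.
by move: i1; rewrite ler_pdivlMr//; lra.
Qed.

Lemma real_cauchy_cvg (u : nat -> R) :
  (forall e : R, 0 < e -> exists N, forall m n, (N <= m)%N -> (N <= n)%N ->
    `|u m - u n| < e) ->
  exists l, forall e, 0 < e -> exists N, forall n, (N <= n)%N -> `|l - u n| < e.
Proof.
move=> uC; have cu : cvgn u.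
  apply/cauchy_cvgP; apply: cauchy_exP => e e0.
  have [N NP] := uC e e0.
  by exists (u N), N => // n Nn; exact: NP.
exists (limn u) => e e0.
by have /cvgrPdist_lt/(_ e e0)[N _ NP] := cu; exists N => n Nn; exact: NP.
Qed.

Lemma scalar_net (M e : R) : 0 < e ->
  exists s : seq K, forall c : K^o, rnorm c <= M ->
    exists2 d : K^o, d \in s & rnorm (c - d) < e.
Proof.
case: k => e0; first exact: real_net.
have e20 : 0 < e / 2 by rewrite divr_gt0.
have [s sP] := real_net M e20.
exists [seq (a +i* b)%C | a <- s, b <- s] => c cM.
have [a sa ca] := sP _ (le_trans (rnorm_Re c) cM).
have [b sb cb] := sP _ (le_trans (rnorm_Im c) cM).
exists (a +i* b)%C; first exact: allpairs_f.
apply: le_lt_trans (rnorm_complex_le _) _.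
by case: c ca cb {cM} => c1 c2 /=; lra.
Qed.

Lemma scalar_complete (u : nat -> K^o) :
  (forall e : R, 0 < e -> exists N, forall m n, (N <= m)%N -> (N <= n)%N ->
    rnorm (u m - u n) < e) ->
  exists l : K^o, u @ \oo --> l.
Proof.
case: k u => u uC.
  by have [l lP] := real_cauchy_cvg uC; exists l; apply/cvg_seq_rnormP.
have [|a aP] := @real_cauchy_cvg (fun n => complex.Re (u n)).
  move=> e /uC[N NP]; exists N => m n Nm Nn.
  apply: le_lt_trans (NP m n Nm Nn).
  by have := rnorm_Re (u m - u n); case: (u m) (u n) => ? ? [].
have [|b bP] := @real_cauchy_cvg (fun n => complex.Im (u n)).
  move=> e /uC[N NP]; exists N => m n Nm Nn.
  apply: le_lt_trans (NP m n Nm Nn).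
  by have := rnorm_Im (u m - u n); case: (u m) (u n) => ? ? [].
exists (a +i* b)%C; apply/cvg_seq_rnormP => e e0.
have e20 : 0 < e / 2 by rewrite divr_gt0.
have [N NP] := aP _ e20; have [M MP] := bP _ e20.
exists (maxn N M) => n; rewrite geq_max => /andP[Nn Mn].
apply: le_lt_trans (rnorm_complex_le _) _.
by have := NP n Nn; have := MP n Mn; case: (u n) => ? ? /=; lra.
Qed.

End scalar_field.

(** * The Hahn-Banach theorem *)

Section hahn_banach.
Context {R : realType} {k : scalar_kind}.
Local Notation K := (scalars R k).
Context {V : normedModType K}.

(** Such a graph is automatically single-valued: the difference of two values at
    [x] and its opposite are both values at [0], hence nonpositive. *)
Definition dominated_graph (G : set (V * R)) : Prop :=
  (forall p q (r : R), G p -> G q -> G (p.1 + toK r *: q.1, p.2 + r * q.2)) /\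
  (forall p, G p -> p.2 <= rnorm p.1).

(** The value [c] given to [x] has to lie between the numbers [a - |y - x|] and
    the numbers [|z + x| - b], for [(y, a)] and [(z, b)] in [G]. *)
Lemma dominated_graph_extend (G : set (V * R)) (x : V) :
  dominated_graph G -> G (0, 0) ->
  exists c, dominated_graph
    [set (p.1 + toK r *: x, p.2 + r * c) | p in G & r in [set: R]].
Proof.
move=> [Gl Gd] G0.
pose S := [set p.2 - rnorm (p.1 - x) | p in G].
have SG p q : G p -> G q -> p.2 - rnorm (p.1 - x) <= rnorm (q.1 + x) - q.2.
  move=> Gp Gq; have := Gd _ (Gl _ _ 1 Gp Gq).
  rewrite toK1 scale1r mul1r /=.
  have -> : p.1 + q.1 = (p.1 - x) + (q.1 + x) by rewrite addrACA addNr addr0.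
  by have := rnormD (p.1 - x) (q.1 + x); lra.
have S0 : S !=set0 by exists (0 - rnorm (0 - x)), (0, 0).
have uS : has_ubound S.
  by exists (rnorm (0 + x) - 0) => _ [p Gp <-]; exact: (SG p (0, 0)).
exists (sup S).
have Sl p : G p -> p.2 - rnorm (p.1 - x) <= sup S.
  by move=> Gp; apply: ub_le_sup => //; exists p.
have Su q : G q -> sup S <= rnorm (q.1 + x) - q.2.
  by move=> Gq; apply: ge_sup => // _ [p Gp <-]; exact: SG.
split=> [_ _ r [p Gp [s _ <-]] [q Gq [t _ <-]] /=|_ [p Gp [r _ <-]] /=].
  exists (p.1 + toK r *: q.1, p.2 + r * q.2); first exact: Gl.
  exists (s + r * t) => //=; congr pair; last by ring.
  by rewrite toKD toKM scalerDl scalerDr scalerA addrACA.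
have Gs s : G (toK s *: p.1, s * p.2).
  by have := Gl _ _ s G0 Gp; rewrite /= !add0r.
have scale s : 0 < s -> forall y : V, rnorm (toK s *: y) = s * rnorm y.
  by move=> s0 y; rewrite rnormZ rnorm_toK gtr0_norm.
have [r0|r0|->] := ltrgt0P r.
- have := Su _ (Gs r^-1); rewrite /= -(ler_pM2l r0) mulrBr -scale//.
  rewrite scalerDr scalerA -toKM mulfV ?gt_eqF// toK1 scale1r.
  by rewrite mulrA mulfV ?gt_eqF// mul1r; lra.
- have s0 : 0 < - r by rewrite oppr_gt0.
  have := Sl _ (Gs (- r)^-1); rewrite /= -(ler_pM2l s0) mulrBr -scale//.
  rewrite scalerBr scalerA -toKM mulfV ?gt_eqF// toK1 scale1r.
  rewrite mulrA mulfV ?gt_eqF// mul1r.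
  have -> : toK (- r) *: x = - (toK r *: x).
    by rewrite -sub0r toKB toK0 sub0r scaleNr.
  by rewrite opprK; lra.
- by rewrite toK0 scale0r mul0r !addr0; exact: Gd.
Qed.

(** The graphs extending that of the functional on the real line through [v] that
    attains the norm have a maximal element, and the previous lemma shows that its
    domain is everything. *)
Lemma real_hahn_banach (v : V) : exists u : V -> R,
  [/\ forall x y, u (x + y) = u x + u y, forall r x, u (toK r *: x) = r * u x,
      forall x, u x <= rnorm x & u v = rnorm v].
Proof.
pose G0 := [set (toK r *: v, r * rnorm v) | r in [set: R]].
have dG0 : dominated_graph G0.
  split=> [_ _ r [s _ <-] [t _ <-] /=|_ [s _ <-] /=].
    by exists (s + r * t) => //; rewrite toKD toKM scalerDl scalerA; congr pair; ring.
  by rewrite rnormZ rnorm_toK ler_wpM2r ?rnorm_ge0 ?ler_norm.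
(* Adding [G0] inside the predicate takes care of the empty chain. *)
have [F FP Ft|A [dA Amax]] := @Zorn_bigcup _ [set G | dominated_graph (G `|` G0)].
  have mem p q : ((\bigcup_(G in F) G) `|` G0) p -> ((\bigcup_(G in F) G) `|` G0) q ->
      exists G, [/\ dominated_graph G, G p, G q & G `<=` (\bigcup_(G in F) G) `|` G0].
    have sub G : F G -> G `|` G0 `<=` (\bigcup_(G in F) G) `|` G0.
      by move=> FG x [Gx|?]; [left; exists G|right].
    move=> [[G FG Gp]|G0p] [[H FH Hq]|G0q].
    - have [GH|HG] := Ft _ _ FG FH.
      + exists (H `|` G0); split; [exact: FP|by left; exact: GH|by left|exact: sub].
      + exists (G `|` G0); split; [exact: FP|by left|by left; exact: HG|exact: sub].
    - by exists (G `|` G0); split; [exact: FP|left|right|exact: sub].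
    - by exists (H `|` G0); split; [exact: FP|right|left|exact: sub].
    - by exists G0; split=> // x; right.
  split=> [p q r Fp Fq|p Fp].
    by have [G [[Gl _] Gp Gq]] := mem _ _ Fp Fq; apply; exact: Gl.
  by have [G [[_ Gd] Gp _ _]] := mem _ _ Fp Fp; exact: Gd.
set G := A `|` G0 in dA; have [Gl Gd] := dA.
have G0v r : G (toK r *: v, r * rnorm v) by right; exists r.
have G00 : G (0, 0) by have := G0v 0; rewrite toK0 scale0r mul0r.
have Gfun x a b : G (x, a) -> G (x, b) -> a = b.
  move=> Ga Gb; apply/le_anti.
  have toKN1 : toK (-1) = -1 :> K by rewrite -sub0r toKB toK0 toK1 sub0r.
  have := Gd _ (Gl _ _ (-1) Ga Gb); have := Gd _ (Gl _ _ (-1) Gb Ga).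
  by rewrite /= toKN1 scaleN1r subrr rnorm0; lra.
have Gtot x : exists a, G (x, a).
  apply: contrapT => nx.
  have [c dc] := dominated_graph_extend x dA G00.
  set G' := (X in dominated_graph X) in dc.
  have GG' : G `<=` G'.
    move=> [y a] Gya; exists (y, a) => //; exists 0 => //=.
    by rewrite toK0 scale0r mul0r !addr0.
  apply: (Amax G').
    split=> [y Ay|G'A]; first by apply: GG'; left.
    apply: nx; exists c; left; apply: G'A; exists (0, 0) => //; exists 1 => //=.
    by rewrite toK1 scale1r !add0r mul1r.
  have G'G0 : G' `|` G0 = G'.
    by apply/seteqP; split=> [y [//|G0y]|y]; [apply: GG'; right|left].
  by rewrite /mkset G'G0.
have [u uG] := choice Gtot; exists u; split=> [x y|r x|x|].
- have := Gl _ _ 1 (uG x) (uG y); rewrite /= toK1 scale1r mul1r.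
  exact: Gfun (uG _).
- by have := Gl _ _ r G00 (uG x); rewrite /= !add0r; exact: Gfun (uG _).
- exact: Gd (uG x).
- by have := G0v 1; rewrite toK1 scale1r mul1r; exact: Gfun (uG _).
Qed.

End hahn_banach.

(** For complex scalars, [u] is the real part of [u x - i * u (i * x)], and
    multiplying [x] by a scalar of modulus one makes the value at [x] real, so that
    the bound on [u] is a bound on the modulus. *)
Lemma hahn_banach (R : realType) (k : scalar_kind)
    (V : normedModType (scalars R k)) (v : V) :
  exists2 f : dual V, rnorm f <= 1 & f v = toK (rnorm v).
Proof.
have [u [uD uZ ub uv]] := real_hahn_banach v.
have uN x : u (- x) = - u x.
  by apply: (addIr (u x)); rewrite -uD !addNr -(scale0r x) -(@toK0 R k) uZ mul0r.
suff [h lh [hb hv]] : exists2 h : V -> (scalars R k)^o, linear h &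
    (forall x, rnorm (h x) <= rnorm x) /\ h v = toK (rnorm v).
  have [|f fP] := @bounded_dual _ _ _ h 1 lh; first by move=> x; rewrite mul1r hb.
  exists f; last by rewrite fP.
  by apply: dual_norm_ub => x x1; rewrite fP (le_trans (hb x)).
case: k V v u uD uZ ub uv uN => V v u uD uZ ub uv uN.
  exists u; first by move=> a x y; rewrite uD; congr +%R; exact: uZ.
  split=> [x|//].
  by rewrite rnorm_real ler_norml ub andbT lerNl -uN (le_trans (ub _))// rnormN.
pose h (x : V) : R[i] := (u x)%:C%C - 'i%C * (u ('i%C *: x))%:C%C.
have hre x : complex.Re (h x) = u x by rewrite /h /=; ring.
have hl : linear (h : V -> (scalars R ComplexScalars)^o).
  move=> a x y.
  have uc (z : V) (c : R[i]) :
      u (c *: z) = complex.Re c * u z + complex.Im c * u ('i%C *: z).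
    rewrite {1}(complexE c) scalerDl uD.
    have -> : (complex.Re c)%:C%C *: z = toK (complex.Re c) *: z by [].
    rewrite uZ; congr +%R.
    by rewrite mulrC -scalerA; have /= -> := uZ (complex.Im c) ('i%C *: z).
  have iaE : 'i%C *: (a *: x) = a *: ('i%C *: x) by rewrite !scalerA mulrC.
  have iiE : 'i%C *: ('i%C *: x) = - x by rewrite scalerA -expr2 sqr_i scaleN1r.
  rewrite -[RHS]/((a : R[i]) * h x + h y) /h scalerDr iaE 2!uD.
  rewrite (uc x a) (uc ('i%C *: x) a) iiE uN.
  move: (u x) (u y) (u ('i%C *: x)) (u ('i%C *: y)) => p q r s.
  case: a {iaE} => a b; apply/eqP; rewrite eq_complex /=.
  by apply/andP; split; apply/eqP; ring.
have hb x : rnorm (h x : (scalars R ComplexScalars)^o) <= rnorm x.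
  have [->|hx0] := eqVneq (h x : (scalars R ComplexScalars)^o) 0.
    by rewrite rnorm0 rnorm_ge0.
  pose c : R[i] := (rnorm (h x : (scalars R ComplexScalars)^o))%:C%C / h x.
  have hcx : h (c *: x) = (rnorm (h x : (scalars R ComplexScalars)^o))%:C%C.
    have := hl c x 0; rewrite addr0.
    have -> : h 0 = 0.
      by rewrite /h scaler0 -(scale0r v) -(@toK0 R ComplexScalars) uZ !mul0r mulr0 subr0.
    by rewrite addr0 => ->; rewrite -[LHS]/(c * h x) /c divfK.
  have c1 : rnorm (c : (scalars R ComplexScalars)^o) = 1.
    apply: (mulIf (x := rnorm (h x : (scalars R ComplexScalars)^o))).
      by rewrite gt_eqF// rnorm_gt0.
    rewrite -rnormM_complex mul1r /c divfK//.
    have /= -> := @rnorm_toK R ComplexScalars (rnorm (h x : (scalars R ComplexScalars)^o)).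
    by rewrite ger0_norm// rnorm_ge0.
  have <- : rnorm (c *: x : V) = rnorm x by rewrite rnormZ c1 mul1r.
  by have := ub (c *: x); rewrite -hre hcx.
exists h => //; split => //.
have := hb v; rewrite /rnorm [reK _]/(complex.Re `|h v|) normc_def /= => hv.
have {}hv : complex.Re (h v) ^+ 2 + complex.Im (h v) ^+ 2 <= rnorm v ^+ 2.
  rewrite -(@ler_sqrt _ _ (rnorm v ^+ 2)) ?sqr_ge0// sqrtr_sqr.
  by rewrite (ger0_norm (rnorm_ge0 v)).
move: hv; rewrite hre uv gerDl => Im0.
have {}Im0 : complex.Im (h v) = 0.
  by apply/eqP; rewrite -sqrf_eq0 -[_ == _]andbT eq_le Im0 sqr_ge0.
by rewrite [LHS](complexE (h v)) Im0 hre uv mulr0 addr0.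
Qed.

(** * Functionals on quotients *)

Section quotient_duality.
Context {R : realType} {k : scalar_kind}.
Local Notation K := (scalars R k).
Context {V : normedModType K} (Z : closed_subspace V).
Local Notation Q := (quot_space Z).
Implicit Types (phi psi : dual Q) (f : dual V).

HB.instance Definition _ := GRing.isLinear.Build K V Q *:%R (quot_map Z)
  (fun a x y => etrans (quot_mapD Z (a *: x) y)
    (congr1 (fun q : Q => q + quot_map Z y) (quot_mapZ Z a x))).

Lemma rnorm_quotE (q : Q) : rnorm q = quot_rnorm q.
Proof. by rewrite /rnorm toKK. Qed.

Lemma rnorm_quot_le x : rnorm (quot_map Z x) <= rnorm x.
Proof. by rewrite rnorm_quotE quot_rnorm_le. Qed.

Lemma quot_lift (q : Q) (e : R) : 0 < e ->
  exists2 x, quot_map Z x = q & rnorm x < rnorm q + e.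
Proof.
move=> e0; apply: contrapT => H.
suff : rnorm q + e <= rnorm q by rewrite gerDl leNgt e0.
rewrite [leRHS]rnorm_quotE; apply: quot_rnorm_ge => x xq; rewrite leNgt.
by apply/negP => xe; apply: H; exists x.
Qed.

Lemma quot_pull_subproof phi : exists f, forall x, f x = phi (quot_map Z x).
Proof.
apply: (@bounded_dual _ _ _ _ (rnorm phi)) => [a x y|x]; first by rewrite !linearP.
by rewrite (le_trans (dual_norm_bound _ _))// ler_wpM2l ?rnorm_ge0 ?rnorm_quot_le.
Qed.

Definition quot_pull phi : dual V := projT1 (cid (quot_pull_subproof phi)).

Lemma quot_pullE phi x : quot_pull phi x = phi (quot_map Z x).
Proof. by rewrite /quot_pull; case: cid. Qed.

Lemma quot_pullB phi psi : quot_pull (phi - psi) = quot_pull phi - quot_pull psi.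
Proof.
apply: dual_eqP => x; rewrite quot_pullE -[RHS]/(quot_pull phi x - quot_pull psi x).
by rewrite !quot_pullE.
Qed.

(** Every vector of the open unit ball of the quotient lifts to the unit ball. *)
Lemma quot_pull_norm phi : rnorm (quot_pull phi) = rnorm phi.
Proof.
apply/le_anti/andP; split; apply: dual_norm_ub => x x1.
  by rewrite quot_pullE dual_norm_ball// (le_trans (rnorm_quot_le _)).
apply/ler_addgt0Pr => e e0.
have d0 : 0 < e / (rnorm (quot_pull phi) + 1).
  by rewrite divr_gt0// ltr_wpDl ?rnorm_ge0.
have [y yx ye] := quot_lift x d0; rewrite -yx -quot_pullE.
apply: le_trans (dual_norm_bound _ _) _.
have : rnorm y <= 1 + e / (rnorm (quot_pull phi) + 1).
  by rewrite (le_trans (ltW ye))// lerD2r.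
have N0 := rnorm_ge0 (quot_pull phi).
move=> /(ler_wpM2l N0) /le_trans; apply.
rewrite mulrDr mulr1 lerD2l mulrCA ler_piMr ?(ltW e0)//.
by rewrite ler_pdivrMr ?mul1r ?lerDl// ltr_wpDl.
Qed.

Lemma quot_push f : (forall z, z \in subspace_pred Z -> f z = 0) ->
  exists phi, forall x, phi (quot_map Z x) = f x.
Proof.
move=> f0.
have fq x y : quot_map Z x = quot_map Z y -> f x = f y.
  by move/quot_mapP => /f0; rewrite linearB => /eqP; rewrite subr_eq0 => /eqP.
pose h (q : Q) : K^o := f (repr q).
have hE x : h (quot_map Z x) = f x by apply: fq; rewrite /quot_map reprK.
have hl : linear h.
  move=> a p q; have [x <-] := quot_map_surj p; have [y <-] := quot_map_surj q.
  by rewrite -linearP !hE linearP.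
have [|phi phiE] := @bounded_dual _ _ _ h (rnorm f) hl; last first.
  by exists phi => x; rewrite phiE.
move=> q; apply/ler_addgt0Pr => e e0.
have d0 : 0 < e / (rnorm f + 1) by rewrite divr_gt0// ltr_wpDl ?rnorm_ge0.
have [x <- xe] := quot_lift q d0; rewrite hE.
apply: le_trans (dual_norm_bound _ _) _.
have N0 := rnorm_ge0 f.
have /(ler_wpM2l N0) /le_trans := ltW xe; apply.
rewrite mulrDr lerD2l mulrCA ler_piMr ?(ltW e0)//.
by rewrite ler_pdivrMr ?mul1r ?lerDl// ltr_wpDl.
Qed.

End quotient_duality.

(** A linear subspace that no nonzero functional annihilates is dense: otherwise
    the quotient by its closure is nonzero, and a functional on the quotient
    given by the Hahn-Banach theorem pulls back to an annihilating one. *)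
Lemma separating_subspace_dense (R : realType) (k : scalar_kind)
    (V : normedModType (scalars R k)) (W : set V) :
  W 0 -> (forall (a : scalars R k) x y, W x -> W y -> W (a *: x + y)) ->
  (forall f : dual V, (forall w, W w -> f w = 0) -> f = 0) ->
  forall x (e : R), 0 < e -> exists2 w, W w & rnorm (x - w) < e.
Proof.
move=> W0 Wl Wt.
pose P : {pred V} := fun x =>
  `[< forall e : R, 0 < e -> exists2 w, W w & rnorm (x - w) < e >].
have PE x : x \in P <->
    forall e : R, 0 < e -> exists2 w, W w & rnorm (x - w) < e.
  by split=> [/asboolP//|xP]; apply/asboolP.
have P0 w : W w -> w \in P.
  by move=> Ww; apply/PE => e e0; exists w => //; rewrite subrr rnorm0.
have Psub : submod_closed P.
  split=> [|a x y /PE Px /PE Py]; first exact: P0.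
  apply/PE => e e0.
  have e20 : 0 < e / 2 by rewrite divr_gt0.
  have a0 : 0 < rnorm (a : _^o) + 1 by rewrite ltr_wpDl ?rnorm_ge0.
  have [w Ww xw] := Px _ (divr_gt0 e20 a0); have [v Wv yv] := Py _ e20.
  exists (a *: w + v); first exact: Wl.
  rewrite opprD addrACA -scalerBr (le_lt_trans (rnormD _ _))// rnormZ.
  have : rnorm (a : _^o) * rnorm (x - w) <= e / 2.
    apply: (@le_trans _ _ ((rnorm (a : _^o) + 1) * rnorm (x - w))).
      by rewrite ler_wpM2r ?rnorm_ge0// lerDl.
    by rewrite mulrC -ler_pdivlMr// ltW.
  by lra.
have Pcl : closed [set x : V | x \in P].
  apply/closed_rnormP => x xP; apply/PE => e e0.
  have e20 : 0 < e / 2 by rewrite divr_gt0.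
  have [y /PE/(_ _ e20)[w Ww yw] xy] := xP _ e20.
  exists w => //; rewrite (le_lt_trans (rnorm_distD y _ _))//; lra.
move=> x; apply/PE; pose Z := ClosedSubspace Psub Pcl.
have [phi _ phix] := hahn_banach (quot_map Z x).
have /(congr1 (fun f : dual V => f x)) : quot_pull phi = 0.
  apply: Wt => w /P0 Pw; rewrite quot_pullE.
  have -> : quot_map Z w = quot_map Z 0 by apply/quot_mapP; rewrite subr0.
  by rewrite !linear0.
rewrite quot_pullE phix -[RHS](@toK0 R k) => /toK_inj/rnorm0_eq0.
rewrite -(linear0 (quot_map Z)) => /quot_mapP.
by rewrite subr0.
Qed.

(** * Finite biorthogonal systems *)

Section biorthogonal_systems.
Context {R : realType} {k : scalar_kind}.
Local Notation K := (scalars R k).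
Context {V : normedModType K}.
Implicit Types (s t : seq (V * dual V)) (f g : dual V) (x v : V).

Definition sproj s x : V := \sum_(p <- s) p.2 x *: p.1.

Definition sdproj s f : dual V := \sum_(p <- s) f p.1 *: p.2.

(** Each pair is orthogonal to the span of the pairs after it, so that [sproj s]
    is a finite-rank projection with adjoint [sdproj s] and a system grows by
    consing. *)
Fixpoint biorthogonal s : Prop :=
  if s is p :: s' then
    [/\ sproj s' p.1 = 0, sdproj s' p.2 = 0, p.2 p.1 = 1 & biorthogonal s']
  else True.

Lemma sproj_cons p s x : sproj (p :: s) x = p.2 x *: p.1 + sproj s x.
Proof. by rewrite /sproj big_cons. Qed.

Lemma sdproj_cons p s f : sdproj (p :: s) f = f p.1 *: p.2 + sdproj s f.
Proof. by rewrite /sdproj big_cons. Qed.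

Lemma sproj_linear s : linear (sproj s).
Proof.
move=> a x y; rewrite /sproj scaler_sumr -big_split; apply: eq_bigr => p _ /=.
by rewrite linearP scalerDl scalerA.
Qed.

HB.instance Definition _ s :=
  GRing.isLinear.Build K V V *:%R (sproj s) (@sproj_linear s).

Lemma sdproj_linear s : linear (sdproj s).
Proof.
move=> a f g; rewrite /sdproj scaler_sumr -big_split; apply: eq_bigr => p _ /=.
by rewrite scalerA -scalerDl.
Qed.

HB.instance Definition _ s :=
  GRing.isLinear.Build K (dual V) (dual V) *:%R (sdproj s) (@sdproj_linear s).

Lemma sdprojE s f x : sdproj s f x = f (sproj s x).
Proof.
rewrite /sdproj /sproj dual_sumE dual_fun_sum; apply: eq_bigr => p _.
by rewrite dual_funZ mulrC.
Qed.

Lemma sproj_idem s x : biorthogonal s -> sproj s (sproj s x) = sproj s x.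
Proof.
elim: s x => [|p s IH] x; first by rewrite /sproj !big_nil.
move=> [pp dp pp1 bs]; rewrite !sproj_cons sproj_linear pp scaler0 add0r.
rewrite IH// dual_funD dual_funZ pp1 mulr1.
have -> : p.2 (sproj s x) = 0 by rewrite -sdprojE dp.
by rewrite addr0.
Qed.

Lemma sdproj_idem s f : biorthogonal s -> sdproj s (sdproj s f) = sdproj s f.
Proof. by move=> bs; apply: dual_eqP => x; rewrite !sdprojE sproj_idem. Qed.

Lemma sproj_fix_cat t s x :
  biorthogonal (t ++ s) -> sproj s x = x -> sproj (t ++ s) x = x.
Proof.
move=> + sx; elim: t => [//|p t IH] /= [pp dp pp1 /IH {}IH].
rewrite sproj_cons IH.
by rewrite -[in X in p.2 X]IH -sdprojE dp scale0r add0r.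
Qed.

Lemma sdproj_fix_cat t s f :
  biorthogonal (t ++ s) -> sdproj s f = f -> sdproj (t ++ s) f = f.
Proof.
move=> + sx; elim: t => [//|p t IH] /= [pp dp pp1 /IH {}IH].
by rewrite sdproj_cons IH -[in X in X *: _]IH sdprojE pp dual_fun0 scale0r add0r.
Qed.

Lemma extend_fix_vector s x : biorthogonal s ->
  exists t, biorthogonal (t ++ s) /\ sproj (t ++ s) x = x.
Proof.
move=> bs; have [/eqP sx|sx] := boolP (sproj s x == x); first by exists [::].
pose y := x - sproj s x.
have y0 : y != 0 by rewrite subr_eq0 eq_sym.
have sy : sproj s y = 0 by rewrite linearB /= sproj_idem// subrr.
have [u2 du2 u2y] : exists2 u2, sdproj s u2 = 0 & u2 y = 1.
  have [u _ uy] := hahn_banach y; pose u1 := toK (rnorm y)^-1 *: u.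
  exists (u1 - sdproj s u1); first by rewrite linearB /= sdproj_idem// subrr.
  rewrite -[LHS]/(u1 y - sdproj s u1 y) sdprojE sy dual_fun0 subr0.
  rewrite -[LHS]/(toK (rnorm y)^-1 * u y) uy -toKM mulVf ?toK1//.
  by rewrite gt_eqF// rnorm_gt0.
exists [:: (y, u2)]; split => //=; rewrite sproj_cons /=.
have -> : u2 x = 1.
  by rewrite -u2y /y dual_funB -(sdprojE s) du2 subr0.
by rewrite scale1r subrK.
Qed.

Lemma extend_fix_vectors s (ws : seq V) : biorthogonal s ->
  exists t, biorthogonal (t ++ s) /\ forall w, w \in ws -> sproj (t ++ s) w = w.
Proof.
move=> bs; elim: ws => [|w ws [t [bt tws]]]; first by exists [::].
have [t' [bt' tw]] := extend_fix_vector w bt.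
exists (t' ++ t); rewrite -catA; split=> // v; rewrite inE => /orP[/eqP->//|vws].
by apply: sproj_fix_cat => //; exact: tws.
Qed.

(** Dual to [extend_fix_vector], but without the Hahn-Banach theorem: a nonzero
    functional takes the value one by definition. *)
Lemma extend_fix_functional s f : biorthogonal s ->
  exists t, biorthogonal (t ++ s) /\ sdproj (t ++ s) f = f.
Proof.
move=> bs; have [/eqP sf|sf] := boolP (sdproj s f == f); first by exists [::].
pose g := f - sdproj s f.
have g0 : g != 0 by rewrite subr_eq0 eq_sym.
have dg : sdproj s g = 0 by rewrite linearB /= sdproj_idem// subrr.
have [x gx] := dual_neq0 g0; pose v := x - sproj s x.
have sv : sproj s v = 0 by rewrite linearB /= sproj_idem// subrr.
have gv : g v = 1 by rewrite /v dual_funB gx -sdprojE dg subr0.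
exists [:: (v, g)]; split => //=; rewrite sdproj_cons /=.
have -> : f v = 1.
  by rewrite -gv -[RHS]/(f v - sdproj s f v) sdprojE sv dual_fun0 subr0.
by rewrite scale1r subrK.
Qed.

Lemma annihilating_functional s : ~ finite_dimensional V -> biorthogonal s ->
  exists2 g, rnorm g = 1 & sdproj s g = 0.
Proof.
move=> nfd bs.
have [x sx] : exists x, sproj s x != x.
  apply: contrapT => H; apply: nfd.
  exists (size s), (fun i => (nth (0, 0) s i).1) => x.
  exists (fun i => (nth (0, 0) s i).2 x).
  have sx : sproj s x = x.
    by apply/eqP; apply: contrapT => /negP sx; apply: H; exists x.
  by rewrite -{1}sx /sproj (big_nth (0, 0)) big_mkord.
have y0 : x - sproj s x != 0 by rewrite subr_eq0 eq_sym.
have [u _ uy] := hahn_banach (x - sproj s x).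
have [g g0 sg] : exists2 g, g != 0 & sdproj s g = 0.
  exists (u - sdproj s u); last by rewrite linearB /= sdproj_idem// subrr.
  apply/eqP => /(congr1 (fun f : dual V => f x)).
  rewrite -[LHS]/(u x - sdproj s u x) sdprojE -dual_funB uy -[RHS](@toK0 R k).
  by move=> /toK_inj/rnorm0_eq0/eqP; rewrite (negPf y0).
exists (toK (rnorm g)^-1 *: g); first exact: rnormZ_inv.
by rewrite linearZ /= sg scaler0.
Qed.

(** The cost of correcting [g] to [g - sdproj s g], which annihilates [s]. *)
Lemma sdproj_small s g (eta : R) : 0 <= eta ->
  (forall v, v \in map fst s -> rnorm (g v) <= eta) ->
  rnorm (sdproj s g) <= eta * \sum_(p <- s) rnorm p.2.
Proof.
move=> eta0; elim: s => [|p s IH] gs.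
  by rewrite /sdproj !big_nil rnorm0 mulr0.
rewrite sdproj_cons big_cons mulrDr (le_trans (rnormD _ _))// lerD//.
  by rewrite rnormZ ler_wpM2r ?rnorm_ge0// gs// mem_head.
by apply: IH => v vs; rewrite gs// inE vs orbT.
Qed.

(** The image of the dual ball is totally bounded because it only depends on
    the bounded scalars [f p.1]. *)
Lemma sdproj_net s (e : R) : 0 < e -> exists L : seq (dual V),
  forall f, rnorm f <= 1 -> exists2 y, y \in L & rnorm (sdproj s f - y) < e.
Proof.
elim: s e => [|p s IH] e e0.
  exists [:: 0] => f _; exists 0; first by rewrite inE.
  by rewrite /sdproj big_nil subrr rnorm0.
have e20 : 0 < e / 2 by rewrite divr_gt0.
have p0 : 0 < rnorm p.2 + 1 by rewrite ltr_wpDl ?rnorm_ge0.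
have [L LP] := IH _ e20.
have [D DP] := @scalar_net R k (rnorm p.1) _ (divr_gt0 e20 p0).
exists [seq (d : K) *: p.2 + y | d <- D, y <- L] => f f1.
have [y yL fy] := LP f f1.
have [|d dD fd] := DP (f p.1).
  by rewrite (le_trans (dual_norm_bound _ _))// ler_piMl ?rnorm_ge0.
exists ((d : K) *: p.2 + y); first exact: (allpairs_f (fun d y => d *: p.2 + y)).
rewrite sdproj_cons opprD addrACA -scalerBl (le_lt_trans (rnormD _ _))// rnormZ.
have : rnorm (f p.1 - d) * rnorm p.2 <= e / 2.
  apply: (@le_trans _ _ (rnorm (f p.1 - d) * (rnorm p.2 + 1))).
    by rewrite ler_wpM2l ?rnorm_ge0// lerDl.
  by rewrite -ler_pdivlMr// ltW.
by lra.
Qed.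

(** A finite net of the ball of the range of [sdproj s], and for each of its
    members a vector of the ball at which the member almost attains its norm. *)
Lemma extend_norming s (delta : R) : 0 < delta -> biorthogonal s ->
  exists t, biorthogonal (t ++ s) /\ forall u, sdproj s u = u ->
    exists w, [/\ rnorm w <= 1, sproj (t ++ s) w = w
      & rnorm u <= (1 + delta) * rnorm (u w)].
Proof.
move=> d0 bs; pose e := delta / (3 * (1 + delta)).
have d1 : 0 < 1 + delta by lra.
have e0 : 0 < e by rewrite divr_gt0// mulr_gt0.
have [L LP] := sdproj_net s e0.
have /choice[W WP] (y : dual V) :
    exists w, rnorm w <= 1 /\ rnorm y - e < rnorm (y w).
  by have [w w1 yw] := dual_norm_near y e0; exists w.
have [t [bt tW]] := extend_fix_vectors (map W L) bs.
exists t; split=> // u su; have [->|u0] := eqVneq u 0.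
  by exists 0; rewrite linear0 !rnorm0 mulr0.
have up : 0 < rnorm u by rewrite rnorm_gt0.
pose u1 := toK (rnorm u)^-1 *: u.
have u11 : rnorm u1 = 1 by exact: rnormZ_inv.
have [|y yL uy] := LP u1; first by rewrite u11.
have su1 : sdproj s u1 = u1 by rewrite linearZ /= su.
rewrite su1 in uy; have [w1 yw] := WP y.
exists (W y); split=> //; first by apply: tW; exact: map_f.
have uw : rnorm (u1 (W y)) = (rnorm u)^-1 * rnorm (u (W y)).
  by rewrite -[u1 _]/(_ * _) rnormM rnorm_toK ger0_norm// invr_ge0 ltW.
have h1 := rnormB_ge (y (W y)) (u1 (W y)).
have h2 : rnorm (y (W y) - u1 (W y)) <= e.
  rewrite rnorm_distC (le_trans (@dual_norm_ball _ _ _ (u1 - y) _ w1))// ltW//.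
have h3 := rnormB_ge u1 y.
have : 1 - 3 * e <= rnorm (u1 (W y)) by rewrite u11 in h3; lra.
have -> : 1 - 3 * e = (1 + delta)^-1 by rewrite /e; field; rewrite gt_eqF.
by rewrite uw ler_pdivlMl// => uw1; rewrite -ler_pdivrMl// mulrC.
Qed.

End biorthogonal_systems.

(** * Quotients with a shrinking basis *)

Section quotient_basis.
Context {R : realType} {k : scalar_kind}.
Local Notation K := (scalars R k).
Context {V : normedModType K}.

(** [e] and [g] are biorthogonal, [g n] annihilates the subspace [W n], and [W n]
    norms, up to the factor [1 + delta], the differences between members of the
    span of the [g i] with [i < n] and functionals that are zero or one of the
    [h j] with [j < n]. *)
Record norming_tower (delta : R) (h : nat -> dual V)
    (W : nat -> set V) (e : nat -> V) (g : nat -> dual V) : Prop := NormingTower {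
  tower0 : forall n, W n 0 ;
  tower_linear : forall n a x y, W n x -> W n y -> W n (a *: x + y) ;
  tower_mono : forall m n, (m <= n)%N -> W m `<=` W n ;
  tower_vec : forall n, W n.+1 (e n) ;
  tower_annihil : forall n w, W n w -> g n w = 0 ;
  tower_diag : forall n, g n (e n) = 1 ;
  tower_lower : forall i n, (i < n)%N -> g i (e n) = 0 ;
  tower_norming : forall n (c : nat -> K) h',
    h' = 0 \/ (exists2 j, (j < n)%N & h' = h j) ->
    exists w, [/\ W n w, rnorm w <= 1
      & rnorm (\sum_(i < n) c i *: g i - h') <=
        (1 + delta) * rnorm ((\sum_(i < n) c i *: g i - h') w)] }.

Lemma sum_kronecker (a : nat -> K) (j n : nat) :
  \sum_(i < n) a i * (j == i :> nat)%:R = if (j < n)%N then a j else 0.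
Proof.
elim: n => [|n IH]; first by rewrite big_ord0.
by rewrite big_ord_recr /= IH ltnS; case: ltngtP => [_|_|<-];
  rewrite ?mulr0 ?mulr1 ?addr0 ?add0r.
Qed.

Lemma common_kernel_submod (g : nat -> dual V) :
  submod_closed (fun x => `[< forall n, g n x = 0 >] : bool).
Proof.
split=> [|a x y /asboolP gx /asboolP gy]; apply/asboolP => n.
  by rewrite dual_fun0.
by rewrite dual_funD dual_funZ gx gy mulr0 addr0.
Qed.

Lemma common_kernel_closed (g : nat -> dual V) :
  closed [set x | x \in ((fun x => `[< forall n, g n x = 0 >]) : {pred V})].
Proof.
apply/closed_rnormP => x xg; apply/asboolP => n; apply: rnorm_le0.
rewrite leNgt; apply/negP => gx0.
have g1 : 0 < rnorm (g n) + 1 by rewrite ltr_wpDl ?rnorm_ge0.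
have [y /asboolP/(_ n) gy xy] := xg _ (divr_gt0 gx0 g1).
have := dual_norm_bound (g n) (x - y); rewrite dual_funB gy subr0 leNgt => /negP.
apply; move: xy; rewrite ltr_pdivlMr// => /(le_lt_trans _); apply.
by rewrite mulrC ler_wpM2l ?rnorm_ge0// lerDl.
Qed.

Definition common_kernel (g : nat -> dual V) : closed_subspace V :=
  ClosedSubspace (common_kernel_submod g) (@common_kernel_closed g).

Lemma common_kernelP (g : nat -> dual V) x :
  x \in subspace_pred (common_kernel g) <-> forall n, g n x = 0.
Proof. by split=> [/asboolP//|gx]; apply/asboolP. Qed.

Context (delta : R) (h : nat -> dual V).
Context (W : nat -> set V) (e : nat -> V) (g : nat -> dual V).
Hypothesis delta_gt0 : 0 < delta.
Hypothesis h_dense :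
  forall (f : dual V) (eta : R), 0 < eta -> exists j, rnorm (f - h j) < eta.
Hypothesis tower : norming_tower delta h W e g.

Local Notation Z := (common_kernel g).
Local Notation Q := (quot_space Z).

Let delta1 : 0 < 1 + delta. Proof. by rewrite addr_gt0. Qed.
Let delta2 : 0 < 2 + delta. Proof. by rewrite addr_gt0. Qed.

Let absorb (p q eta : R) :
  p < eta / (2 + delta) -> q <= (1 + delta) * p -> p + q < eta.
Proof.
rewrite ltr_pdivlMr// => pe /(lerD (lexx p)) /le_lt_trans; apply.
by apply: le_lt_trans pe; rewrite le_eqVlt; apply/orP; left; apply/eqP; ring.
Qed.

Lemma tower_biorthogonal i n : g i (e n) = (i == n)%:R.
Proof.
case: ltngtP => [ltin|ltni|->]; first by rewrite (tower_lower tower).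
  apply: (tower_annihil tower); apply: (tower_mono tower ltni).
  exact: (tower_vec tower).
by rewrite (tower_diag tower).
Qed.

(** A functional annihilating every [W n] is close to some [h j], which is then
    almost annihilated by [W j.+1] and thus small. *)
Lemma tower_dense x (eta : R) : 0 < eta ->
  exists n w, W n w /\ rnorm (x - w) < eta.
Proof.
pose U := [set w | exists n, W n w].
suff Ud : forall x (eta : R), 0 < eta -> exists2 w, U w & rnorm (x - w) < eta.
  by move=> /(Ud x)[w [n Ww] xw]; exists n, w.
apply: separating_subspace_dense => [|a y z [m Wy] [n Wz]|f fU].
- by exists 0%N; exact: (tower0 tower).
- exists (maxn m n); apply: (tower_linear tower).
    exact: (tower_mono tower (leq_maxl m n)).
  exact: (tower_mono tower (leq_maxr m n)).
apply: rnorm_le0; rewrite leNgt; apply/negP => f0.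
have d0 : 0 < rnorm f / (2 + delta) by rewrite divr_gt0.
have [j fj] := h_dense f d0.
have [w [Ww w1]] := tower_norming tower (fun=> 0)
  (or_intror (ex_intro2 _ _ j (ltnSn j) erefl)).
rewrite big1 => [|i _]; last by rewrite scale0r.
rewrite sub0r rnormN -[(- h j) w]/(- h j w) => hj.
have fw : f w = 0 by apply: fU; exists j.+1.
have {}hj : rnorm (h j) <= (1 + delta) * rnorm (f - h j).
  apply: le_trans hj _; rewrite ler_wpM2l// ?(ltW delta1)//.
  rewrite -[- h j w]add0r -{1}fw -[f w - h j w]/((f - h j) w).
  exact: dual_norm_ball.
have := rnormD (f - h j) (h j); rewrite subrK leNgt => /negP; apply.
exact: absorb.
Qed.

(** [g n] vanishes on [W N] for all [n >= N], and some [W N] comes close to [x]. *)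
Lemma tower_null_functionals (M : R) x (eta : R) : 0 < eta ->
  exists N, forall n, (N <= n)%N -> rnorm (g n) <= M -> rnorm (g n x) < eta.
Proof.
move=> eta0; have M1 : 0 < `|M| + 1 by rewrite ltr_pwDr.
have [N [w [Ww xw]]] := tower_dense x (divr_gt0 eta0 M1).
exists N => n Nn gM.
have -> : g n x = g n (x - w).
  by rewrite dual_funB (tower_annihil tower (tower_mono tower Nn Ww)) subr0.
rewrite (le_lt_trans (dual_norm_bound _ _))//.
rewrite ltr_pdivlMr// mulrC in xw; apply: le_lt_trans xw.
rewrite ler_wpM2r ?rnorm_ge0// (le_trans gM)// (le_trans (ler_norm M))//.
by rewrite lerDl.
Qed.

Let b n : Q := quot_map Z (e n).

Lemma quotient_coordinates : exists gq : nat -> dual Q,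
  forall n x, gq n (quot_map Z x) = g n x.
Proof.
have /choice[gq gqP] n : exists f : dual Q, forall x, f (quot_map Z x) = g n x.
  by apply: quot_push => z /common_kernelP.
by exists gq.
Qed.

Section coordinates.
Context (gq : nat -> dual Q) (gqE : forall n x, gq n (quot_map Z x) = g n x).

Let S n (y : Q) : Q := \sum_(i < n) gq i y *: b i.
Let A n (phi : dual Q) : dual Q := \sum_(i < n) phi (b i) *: gq i.

Lemma partial_sum_adjoint n phi y : A n phi y = phi (S n y).
Proof.
rewrite /A /S dual_sumE dual_fun_sum; apply: eq_bigr => i _.
by rewrite dual_funZ mulrC.
Qed.

(** The difference of the two sides is killed by [g j] for [j < n] by
    biorthogonality, and for the other [j] because [g j] vanishes on [W n] and on
    [e i] for [i < n]. *)
Lemma partial_sum_tower n w : W n w -> S n (quot_map Z w) = quot_map Z w.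
Proof.
move=> Ww; have -> : S n (quot_map Z w) = quot_map Z (\sum_(i < n) g i w *: e i).
  by rewrite /S linear_sum; apply: eq_bigr => i _; rewrite linearZ gqE.
apply/esym/quot_mapP/common_kernelP => j; rewrite dual_funB dual_fun_sum.
under eq_bigr do rewrite dual_funZ tower_biorthogonal.
rewrite (sum_kronecker (fun i => g i w)); case: ltnP => [_|nj].
  by rewrite subrr.
by rewrite (tower_annihil tower (tower_mono tower nj Ww)) subrr.
Qed.

(** On [W n] the functional [A n phi] agrees with [phi], and [W n] norms its
    distance to [h']. *)
Lemma adjoint_distance n phi h' :
  h' = 0 \/ (exists2 j, (j < n)%N & h' = h j) ->
  rnorm (quot_pull (A n phi) - h') <= (1 + delta) * rnorm (quot_pull phi - h').
Proof.
move=> h'P.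
have AE : quot_pull (A n phi) = \sum_(i < n) phi (b i) *: g i.
  apply: dual_eqP => x; rewrite quot_pullE /A !dual_sumE; apply: eq_bigr => i _.
  by rewrite -[LHS]/(phi (b i) * gq i (quot_map Z x)) gqE.
have [w [Ww w1]] := tower_norming tower (fun i => phi (b i)) h'P.
rewrite -AE => /le_trans; apply; rewrite ler_wpM2l// ?(ltW delta1)//.
have -> : (quot_pull (A n phi) - h') w = (quot_pull phi - h') w.
  rewrite -[LHS]/(quot_pull (A n phi) w - h' w) -[RHS]/(quot_pull phi w - h' w).
  by rewrite !quot_pullE partial_sum_adjoint partial_sum_tower.
exact: dual_norm_ball.
Qed.

(** Test the partial sum against a functional that norms it, and compare the
    adjoint image of that functional with [0]. *)
Lemma partial_sum_bound n y : rnorm (S n y) <= (1 + delta) * rnorm y.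
Proof.
have [phi phi1 phiS] := hahn_banach (S n y).
have := dual_norm_bound (A n phi) y; rewrite partial_sum_adjoint phiS rnorm_toK.
rewrite ger0_norm ?rnorm_ge0// => /le_trans; apply.
rewrite ler_wpM2r ?rnorm_ge0//.
have := @adjoint_distance n phi 0 (or_introl erefl); rewrite !subr0 !quot_pull_norm.
by move=> /le_trans; apply; rewrite ler_piMr// ltW.
Qed.

Lemma partial_sum_cvg y : (fun n => S n y) @ \oo --> y.
Proof.
apply/cvg_seq_rnormP => eta eta0; have [x <-] := quot_map_surj y.
have d0 : 0 < eta / (2 + delta) by rewrite divr_gt0.
have [n [w [Ww xw]]] := tower_dense x d0.
exists n => m nm; rewrite (le_lt_trans (rnorm_distD (quot_map Z w) _ _))//.
rewrite -{2}(partial_sum_tower (tower_mono tower nm Ww)).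
have -> : S m (quot_map Z w) - S m (quot_map Z x) = S m (quot_map Z (w - x)).
  rewrite /S -sumrB linearB; apply: eq_bigr => i _.
  by rewrite -scalerBl dual_funB.
have le1 : rnorm (quot_map Z x - quot_map Z w) <= rnorm (x - w).
  by rewrite -linearB; exact: rnorm_quot_le.
apply: le_lt_trans (lerD le1 (lexx _)) _; apply: absorb => //.
apply: le_trans (partial_sum_bound m _) _; rewrite ler_wpM2l ?(ltW delta1)//.
by rewrite rnorm_distC rnorm_quot_le.
Qed.

Lemma expansion_unique y (a : K ^nat) :
  is_expansion b y a -> a = fun n => gq n y.
Proof.
move=> ay; apply/funext => n.
have gb i : gq n (b i) = (n == i)%:R by rewrite /b gqE tower_biorthogonal.
apply/eqP; rewrite -subr_eq0; apply/eqP/(@rnorm_le0 _ _ (K^o)).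
rewrite leNgt; apply/negP => r0.
have N1 : 0 < rnorm (gq n) + 1 by rewrite ltr_wpDl ?rnorm_ge0.
have /cvg_seq_rnormP/(_ _ (divr_gt0 r0 N1))[N NP] := ay.
have := NP (maxn N n.+1) (leq_maxl _ _); set m := maxn N n.+1 => ym.
have := dual_norm_bound (gq n) (y - series (fun n => a n *: b n) m).
have -> : gq n (y - series (fun n => a n *: b n) m) = gq n y - a n.
  rewrite dual_funB /series /= dual_fun_sum big_mkord; congr (_ - _).
  under eq_bigr do rewrite dual_funZ gb.
  by rewrite sum_kronecker leq_maxr.
rewrite (@rnorm_distC _ _ (K^o)) leNgt => /negP; apply.
move: ym; rewrite ltr_pdivlMr// => /(le_lt_trans _); apply.
by rewrite mulrC ler_wpM2l ?rnorm_ge0// lerDl.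
Qed.

Lemma coordinate_expansion y : is_expansion b y (fun n => gq n y).
Proof.
rewrite /is_expansion.
have -> : series (fun n => gq n y *: b n) = fun n => S n y.
  by apply/funext => n; rewrite /series /= big_mkord.
exact: partial_sum_cvg.
Qed.

Lemma basis_coefE y : basis_coef b y = fun n => gq n y.
Proof.
rewrite /basis_coef; case: xgetP => [a _ /expansion_unique//|].
by move=> /(_ (fun n => gq n y)) []; exact: coordinate_expansion.
Qed.

(** Take [h' = h j] close to the pull-back of [phi] in [adjoint_distance]. *)
Lemma adjoint_approx phi (eta : R) : 0 < eta ->
  exists n, rnorm (phi - A n phi) < eta.
Proof.
move=> eta0; have d0 : 0 < eta / (2 + delta) by rewrite divr_gt0.
have [j fj] := h_dense (quot_pull phi) d0; exists j.+1.
rewrite -quot_pull_norm quot_pullB (le_lt_trans (rnorm_distD (h j) _ _))//.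
have := @adjoint_distance j.+1 phi (h j) (or_intror (ex_intro2 _ _ j (ltnSn j) erefl)).
by move=> hA; apply: absorb fj _; rewrite rnorm_distC.
Qed.

End coordinates.

Theorem quotient_shrinking_basis :
  [/\ schauder_basis b, shrinking b & (basis_constant b <= (1 + delta)%:E)%E].
Proof.
have [gq gqE] := quotient_coordinates; split.
- move=> y; exists (fun n => gq n y); split; first exact: coordinate_expansion.
  by move=> a /(expansion_unique gqE).
- exists gq; split=> [n x|]; first by rewrite (basis_coefE gqE).
  apply/dense_rnormP => phi eta /(adjoint_approx gqE phi)[n phin].
  by exists (\sum_(i < n) phi (b i) *: gq i) => //; exists n, (fun i => phi (b i)).
- apply: ge_ereal_sup => _ [n _ <-]; apply: ge_ereal_sup => _ [y /unit_ballE y1 <-].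
  rewrite lee_fin /basis_proj (basis_coefE gqE).
  apply: le_trans (partial_sum_bound gqE n y) _.
  by rewrite ler_piMr// ltW.
Qed.

End quotient_basis.

(** Norms are generalized first because comparing two of them by conversion
    unfolds suprema. *)
Ltac norm_lra :=
  repeat match goal with
  | H : is_true (@Order.le _ _ _ _) |- _ => revert H
  | H : is_true (@Order.lt _ _ _ _) |- _ => revert H
  end;
  repeat match goal with
  | |- context [@ndist ?R ?k ?V ?x ?y] => generalize (@ndist R k V x y)
  | |- context [@rnorm ?R ?k ?V ?x] => generalize (@rnorm R k V x)
  end;
  intros; lra.

(** * Szlenk derivations *)

Section szlenk_derivations.
Context {R : realType} {k : scalar_kind}.
Local Notation K := (scalars R k).
Context {V : normedModType K}.
Implicit Types (f g : dual V) (L : set (dual V)) (vs : seq V) (d : ord) (eps : R).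

Definition weak_star_close vs (eta : R) f g :=
  forall v, v \in vs -> ndist (g v : K^o) (f v) < eta.

Lemma szlenk_derivationP eps L f : szlenk_derivation eps L f <->
  L f /\ forall vs (eta : R), 0 < eta -> exists g1 g2,
    [/\ L g1 /\ L g2, weak_star_close vs eta f g1, weak_star_close vs eta f g2
      & eps < ndist g1 g2].
Proof.
split=> [[Lf fL]|[Lf fL]]; split=> //.
  move=> vs eta eta0.
  have := weak_star_nbhs f vs eta0; rewrite nbhsE => -[U [oU Uf] UA].
  have /ereal_sup_gt[_ [[g1 g2] [/= [Ug1 Lg1] [Ug2 Lg2]] <-]] := fL U oU Uf.
  by rewrite lte_fin => g12; exists g1, g2; split=> //; exact: UA.
move=> U oU Uf; have [vs [eta eta0 UB]] := weak_star_basis oU Uf.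
have [g1 [g2 [[Lg1 Lg2] g1f g2f g12]]] := fL vs eta eta0.
apply: (@lt_le_trans _ _ (ndist g1 g2)%:E); first by rewrite lte_fin.
by apply: ereal_sup_ubound; exists (g1, g2) => //; split; split=> //; exact: UB.
Qed.

(** Of two points at distance more than [eps], one is at distance more than
    [eps / 2] from [h]. *)
Lemma szlenk_derivation_far eps L f (h : dual V) vs (eta : R) : 0 < eta ->
  szlenk_derivation eps L f ->
  exists g, [/\ L g, weak_star_close vs eta f g & eps / 2 < ndist g h].
Proof.
move=> eta0 /szlenk_derivationP[_ /(_ vs eta eta0)].
move=> [g1 [g2 [[Lg1 Lg2] g1f g2f g12]]].
have [g1h|/negP] := pselect (eps / 2 < ndist g1 h).
  by exists g1; split.
rewrite -leNgt => g1h; exists g2; split; [by []|by []|].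
by have := ndist_triangle h g1 g2; rewrite (ndistC h); norm_lra.
Qed.

(** ** Weak* sequentially closed sets *)

Definition weak_star_seq_closed L := forall (F : nat -> dual V) f,
  (forall n, L (F n)) -> (forall x, (fun n => F n x) @ \oo --> f x) -> L f.

Lemma ptws_cvg_close (F : nat -> dual V) f vs (eta : R) : 0 < eta ->
  (forall x, (fun n => F n x) @ \oo --> f x) ->
  exists N, forall n, (N <= n)%N -> weak_star_close vs eta f (F n).
Proof.
move=> eta0 Ff; elim: vs => [|v vs [N NP]]; first by exists 0%N => n _ v.
have /cvg_seq_ndistP/(_ eta eta0)[M MP] := Ff v.
exists (maxn N M) => n; rewrite geq_max => /andP[Nn Mn] w.
rewrite inE => /orP[/eqP->|wvs]; first by rewrite ndistC MP.
exact: NP.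
Qed.

Lemma derivation_seq_closed eps L :
  weak_star_seq_closed L -> weak_star_seq_closed (szlenk_derivation eps L).
Proof.
move=> cL F f LF Ff; apply/szlenk_derivationP; split.
  by apply: cL Ff => n; have [] := LF n.
move=> vs eta eta0; have eta20 : 0 < eta / 2 by rewrite divr_gt0.
have [N NP] := ptws_cvg_close vs eta20 Ff.
have /szlenk_derivationP[_ /(_ vs _ eta20)] := LF N.
move=> [g1 [g2 [Lg g1F g2F g12]]]; exists g1, g2.
have close g : weak_star_close vs (eta / 2) (F N) g -> weak_star_close vs eta f g.
  move=> gF v vin; have := NP N (leqnn N) v vin; have := gF v vin.
  by have := ndist_triangle (F N v : K^o) (g v) (f v); norm_lra.
by split=> //; exact: close.
Qed.

Lemma unit_ball_seq_closed : weak_star_seq_closed (unit_ball (dual V)).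
Proof.
move=> F f BF Ff; apply/unit_ballE; apply: dual_norm_ub => x x1.
apply/ler_addgt0Pr => e e0.
have /cvg_seq_ndistP/(_ e e0)[N /(_ N (leqnn N)) fN] := Ff x.
have /unit_ballE F1 := BF N.
have := le_trans (dual_norm_ball (F N) x1) F1.
by have := rnorm_le_ndist (F N x : K^o) (f x); norm_lra.
Qed.

Lemma iter_seq_closed eps L d :
  weak_star_seq_closed L -> weak_star_seq_closed (szlenk_iter eps L d).
Proof.
move=> cL; elim: d => [//|d IH|A u IH] /=; first exact: derivation_seq_closed.
move=> F f LF Ff; split; first by apply: cL Ff => n; have [] := LF n.
by move=> i _; apply: IH Ff => n; have [_] := LF n; exact.
Qed.

Lemma seq_closed_norm_closed L f : weak_star_seq_closed L -> ~ L f ->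
  exists2 e : R, 0 < e & forall g, ndist f g < e -> ~ L g.
Proof.
move=> cL nLf; apply: contrapT => H; apply: nLf.
have /choice[F FP] (n : nat) : exists g, ndist f g < n.+1%:R^-1 /\ L g.
  apply: contrapT => nH; apply: H; exists n.+1%:R^-1 => // g gn.
  by apply: contra_not nH => Lg; exists g.
apply: (cL F) => [n|x]; first by have [] := FP n.
apply/cvg_seq_ndistP => e e0.
have [N NE] : exists N : nat, (rnorm x + 1) / e < N.+1%:R.
  by exists (Num.truncn ((rnorm x + 1) / e)); rewrite truncnS_gt.
exists N => n Nn; apply: (le_lt_trans (dual_ndist_bound _ _ _)).
have [/ltW Fn _] := FP n.
apply: (le_lt_trans (ler_wpM2r (rnorm_ge0 x) Fn)).
rewrite ltr_pdivrMl//; apply: (@lt_le_trans _ _ (N.+1%:R * e)).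
  by rewrite -ltr_pdivrMr// (le_lt_trans _ NE)// ler_pM2r ?invr_gt0// lerDl.
by rewrite ler_pM2r// ler_nat.
Qed.

Lemma szlenk_iter_subset eps L d : szlenk_iter eps L d `<=` L.
Proof. exact: (@szlenk_iter_ole _ _ _ eps L OZero d I). Qed.

(** ** Derivations are proper when the dual is separable *)

(** The scalars are complete, and pointwise limits keep linearity and bounds. *)
Lemma ptws_limit (F : nat -> dual V) : (forall n, rnorm (F n) <= 1) ->
  (forall x (e : R), 0 < e -> exists N, forall m n, (N <= m)%N -> (N <= n)%N ->
    ndist (F m x : K^o) (F n x) < e) ->
  exists f, forall x, (fun n => F n x) @ \oo --> f x.
Proof.
move=> F1 FC.
have /choice[l lP] x : exists l : K^o, (fun n => F n x) @ \oo --> l.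
  by apply: scalar_complete => e /(FC x).
have [||f fP] := @bounded_dual _ _ V l 1.
- move=> a x y; apply: (@cvg_unique K^o _ ((fun n => F n (a *: x + y)) @ \oo)).
  + exact: norm_hausdorff.
  + exact: lP.
  + have -> : (fun n => F n (a *: x + y)) = (fun n => a *: (F n x : K^o) + F n y).
      by apply/funext => n; rewrite dual_funD dual_funZ.
    by apply: cvgD; [apply: cvgZr; exact: lP|exact: lP].
- move=> x; rewrite mul1r; apply/ler_addgt0Pr => e e0.
  have /cvg_seq_ndistP/(_ e e0)[N /(_ N (leqnn N)) fN] := lP x.
  have := le_trans (dual_norm_bound (F N) x) (ler_wpM2r (rnorm_ge0 x) (F1 N)).
  by have := rnorm_le_ndist (F N x : K^o) (l x); norm_lra.
by exists f => x; rewrite fP.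
Qed.

(** The vectors at which a bounded sequence of functionals is Cauchy form a closed
    subspace, so it suffices to consider a total sequence of vectors. *)
Lemma ptws_cauchy_total (F : nat -> dual V) (x : nat -> V) :
  (forall f, (forall n, f (x n) = 0) -> f = 0) ->
  (forall n, rnorm (F n) <= 1) ->
  (forall j (e : R), 0 < e -> exists N, forall m n, (N <= m)%N -> (N <= n)%N ->
    ndist (F m (x j) : K^o) (F n (x j)) < e) ->
  forall y (e : R), 0 < e -> exists N, forall m n, (N <= m)%N -> (N <= n)%N ->
    ndist (F m y : K^o) (F n y) < e.
Proof.
move=> xt F1 Fx; pose U := [set y | forall e : R, 0 < e ->
  exists N, forall m n, (N <= m)%N -> (N <= n)%N -> ndist (F m y : K^o) (F n y) < e].
have Ul a y z : U y -> U z -> U (a *: y + z).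
  move=> Uy Uz e e0; have e20 : 0 < e / 2 by rewrite divr_gt0.
  have a1 : 0 < rnorm (a : K^o) + 1 by rewrite ltr_wpDl ?rnorm_ge0.
  have [N NP] := Uy _ (divr_gt0 e20 a1); have [M MP] := Uz _ e20.
  exists (maxn N M) => m n; rewrite !geq_max => /andP[Nm Mm] /andP[Nn Mn].
  rewrite /ndist !dual_funD !dual_funZ opprD addrACA -mulrBr.
  rewrite (le_lt_trans (rnormD _ _))// rnormM.
  have := NP m n Nm Nn; rewrite ltr_pdivlMr// => /ltW h1.
  have h2 := MP m n Mm Mn; rewrite [ltRHS]splitr ler_ltD//.
  apply: le_trans h1; rewrite mulrC ler_wpM2l ?rnorm_ge0//.
  by rewrite lerDl.
have U0 : U 0.
  by move=> e e0; exists 0%N => m n _ _; rewrite !dual_fun0 ndistxx.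
move=> y e e0; have e40 : 0 < e / 4 by rewrite divr_gt0.
have e20 : 0 < e / 2 by rewrite divr_gt0.
have [f fU|w Uw yw] := separating_subspace_dense U0 Ul _ y e40.
  by apply: xt => n; apply: fU; exact: Fx.
have [N NP] := Uw _ e20; exists N => m n Nm Nn.
have {}yw : ndist y w < e / 4 by exact: yw.
have Fw p : ndist (F p y : K^o) (F p w) <= ndist y w.
  rewrite /ndist -dual_funB (le_trans (dual_norm_bound _ _))//.
  by rewrite ler_piMl ?rnorm_ge0.
have h1 := ndist_triangle (F m w : K^o) (F m y) (F n y).
have h2 := ndist_triangle (F n w : K^o) (F m w) (F n y).
have := NP m n Nm Nn; have := Fw m; have := Fw n.
by rewrite (ndistC (F n y : K^o)); norm_lra.
Qed.

Context (h : nat -> dual V).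
Hypothesis h_dense :
  forall (f : dual V) (eta : R), 0 < eta -> exists j, ndist f (h j) < eta.

(** Vectors at which the dense functionals [h j] take at least half their norm. *)
Lemma total_sequence : exists x : nat -> V,
  forall f, (forall n, f (x n) = 0) -> f = 0.
Proof.
have /choice[x xP] j : exists x, rnorm x <= 1 /\ rnorm (h j) <= 2 * rnorm (h j x).
  have [->|hj0] := eqVneq (h j) 0.
    by exists 0; rewrite !rnorm0; split; rewrite ?ler01// mulr_ge0 ?rnorm_ge0.
  have e0 : 0 < rnorm (h j) / 2 by rewrite divr_gt0// rnorm_gt0.
  by have [x x1 hx] := dual_norm_near (h j) e0; exists x; split=> //; norm_lra.
exists x => f fx; apply: rnorm_le0; rewrite leNgt; apply/negP => f0.
have e0 : 0 < rnorm f / 4 by rewrite divr_gt0.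
have [j fj] := h_dense f e0; have [x1 hx] := xP j.
have := dual_ndist_ball f (h j) x1; rewrite fx ndistC ndistx0.
by have := rnorm_le_ndist (h j) f; norm_lra.
Qed.

(** If the derivation fixed [L], one could choose functionals [F n] in [L], each
    far from [h n] at some vector [y n] and so close weak* to its predecessor that
    the sequence converges weak*, to a functional far from every [h n]. *)
Lemma szlenk_derivation_proper eps L : 0 < eps -> L !=set0 ->
  weak_star_seq_closed L -> L `<=` unit_ball (dual V) ->
  exists2 f, L f & ~ szlenk_derivation eps L f.
Proof.
move=> eps0 [f0 Lf0] cL LB; apply: contrapT => H.
have Ls f : L f -> szlenk_derivation eps L f.
  by move=> Lf; apply: contrapT => nLf; apply: H; exists f.
have [x xt] := total_sequence.
(* The steps from [n] on move each controlled value by at most [c n], because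
   [c n / 2 = c n - c n.+1]. *)
pose c (n : nat) : R := eps / 4 * (2^-1 ^+ n).
have c_gt0 n : 0 < c n by rewrite mulr_gt0 ?divr_gt0 ?exprn_gt0 ?invr_gt0.
have cS n : c n.+1 = c n / 2 by rewrite /c exprSr mulrA.
pose T : Type := {f | L f} * seq V.
have step n (s : T) : exists s' : T, exists y,
    [/\ weak_star_close s.2 (c n / 2) (sval s.1) (sval s'.1),
        s'.2 = y :: x n :: s.2, rnorm y <= 1
      & eps / 2 < ndist (sval s'.1 y : K^o) (h n y)].
  case: s => -[f Lf] vs.
  have cn : 0 < c n / 2 by rewrite divr_gt0.
  have [g [Lg gf gh]] := szlenk_derivation_far (h n) vs cn (Ls f Lf).
  have gh0 : 0 < ndist g (h n) - eps / 2 by rewrite subr_gt0.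
  have [y y1 yg] := dual_norm_near (g - h n) gh0.
  exists (exist _ g Lg, y :: x n :: vs), y; split => //=.
  by move: yg; rewrite -/(ndist g (h n)) opprB addrCA subrr addr0.
have /choice[next nextP] : forall p : nat * T, exists s' : T, exists y,
    [/\ weak_star_close p.2.2 (c p.1 / 2) (sval p.2.1) (sval s'.1),
        s'.2 = y :: x p.1 :: p.2.2, rnorm y <= 1
      & eps / 2 < ndist (sval s'.1 y : K^o) (h p.1 y)].
  by case=> n s; exact: step.
pose st := fix st n : T :=
  if n is n'.+1 then next (n', st n') else (exist _ f0 Lf0, [::]).
pose F n := sval (st n).1; pose vs n := (st n).2.
have /choice[y yP] n : exists y,
    [/\ weak_star_close (vs n) (c n / 2) (F n) (F n.+1),
        vs n.+1 = y :: x n :: vs n, rnorm y <= 1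
      & eps / 2 < ndist (F n.+1 y : K^o) (h n y)] := nextP (n, st n).
have vs_mono m n : (m <= n)%N -> {subset vs m <= vs n}.
  elim: n => [|n IH]; first by rewrite leqn0 => /eqP->.
  rewrite leq_eqVlt => /orP[/eqP->//|]; rewrite ltnS => /IH mn v /mn vn.
  by have [_ -> _ _] := yP n; rewrite !inE vn !orbT.
have FL n : L (F n) by rewrite /F; case: (st n).1.
have F1 n : rnorm (F n) <= 1 by apply/unit_ballE; exact: LB.
have Fvs m n v : v \in vs m -> (m <= n)%N -> ndist (F n v : K^o) (F m v) <= c m - c n.
  move=> vm; elim: n => [|n IH].
    by rewrite leqn0 => /eqP->; rewrite subrr ndistxx.
  rewrite leq_eqVlt => /orP[/eqP<-|]; first by rewrite subrr ndistxx.
  rewrite ltnS => mn; have [/(_ v (vs_mono _ _ mn _ vm)) Fn _ _ _] := yP n.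
  have := IH mn; have := ndist_triangle (F n v : K^o) (F n.+1 v) (F m v).
  by rewrite cS; norm_lra.
have c_to0 (e : R) : 0 < e -> exists N, forall n, (N <= n)%N -> c n < e.
  move=> e0; have : (c : R^o ^nat) @ \oo --> (0 : R^o).
    rewrite -[X in _ --> X](mulr0 (eps / 4)); apply: cvgMl_tmp.
    by apply: cvg_expr; rewrite ger0_norm ?invr_ge0// invf_lt1// ltr1n.
  move=> /cvgrPdist_lt/(_ e e0)[N _ NP]; exists N => n /NP /=.
  by rewrite sub0r normrN gtr0_norm.
have [|f fP] := ptws_limit F1.
  apply: (ptws_cauchy_total xt F1) => j e e0.
  have [N NP] := c_to0 _ (divr_gt0 e0 (ltr0Sn R 1)).
  have xj : x j \in vs j.+1 by have [_ -> _ _] := yP j; rewrite !inE eqxx orbT.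
  have FN n : (maxn N j.+1 <= n)%N ->
      ndist (F n (x j) : K^o) (F (maxn N j.+1) (x j)) < e / 2.
    move=> Nn; apply: le_lt_trans (Fvs _ _ _ _ Nn) _.
      by apply: vs_mono xj; exact: leq_maxr.
    by have := NP _ (leq_maxl N j.+1); have := c_gt0 n; norm_lra.
  exists (maxn N j.+1) => m n /FN h1 /FN h2.
  have := ndist_triangle (F (maxn N j.+1) (x j) : K^o) (F m (x j)) (F n (x j)).
  by rewrite (ndistC (F (maxn N j.+1) (x j) : K^o)); norm_lra.
have e80 : 0 < eps / 8 by rewrite divr_gt0.
have [n fn] := h_dense f e80.
have [_ vsS y1 yF] := yP n.
have /cvg_seq_ndistP/(_ _ e80)[N NP] := fP (y n).
have := NP _ (leq_maxl N n.+1); set m := maxn N n.+1 => fm.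
have : ndist (F m (y n) : K^o) (F n.+1 (y n)) <= c n.+1 - c m.
  by apply: Fvs; [rewrite vsS inE eqxx|exact: leq_maxr].
have c1 : c n.+1 <= eps / 8.
  rewrite /c exprSr mulrA [leRHS](_ : _ = eps / 4 / 2); last by field.
  rewrite ler_pM2r ?invr_gt0// ler_piMr ?divr_ge0 ?(ltW eps0)//.
  by rewrite exprn_ile1 ?invr_ge0// invf_le1 ?ler1n.
have := le_trans (dual_ndist_ball f (h n) y1) (ltW fn).
have := ndist_triangle (F m (y n) : K^o) (F n.+1 (y n)) (h n (y n)).
have := ndist_triangle (f (y n) : K^o) (F m (y n)) (h n (y n)).
rewrite (ndistC (F n.+1 (y n) : K^o) (F m _)) (ndistC (F m (y n) : K^o) (f _)).
by have := c_gt0 m; clear vsS; norm_lra.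
Qed.

(** ** The Szlenk index of a space with separable dual *)

Local Notation B := (unit_ball (dual V)).

(** Each nonempty iterate is determined by any norm ball of a countable base that
    it meets but the next iterate misses. *)
Lemma szlenk_iter_countable eps : 0 < eps -> exists L : nat * nat -> set (dual V),
  (forall i, L i `<=` B) /\
  forall d, szlenk_iter eps B d !=set0 -> exists i, szlenk_iter eps B d = L i.
Proof.
move=> eps0.
pose split_at (i : nat * nat) d :=
  (exists2 f, szlenk_iter eps B d f & ndist f (h i.1) < i.2.+1%:R^-1) /\
  forall f, ndist f (h i.1) < i.2.+1%:R^-1 -> ~ szlenk_iter eps B (OSucc d) f.
have not_lt i d d' : split_at i d -> split_at i d' -> ~ olt d d'.
  move=> [_ dS] [[f d'f fi] _] dd'; apply: (dS f fi).
  exact: (@szlenk_iter_ole _ _ _ eps B (OSucc d) d' dd').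
exists (fun i => [set f | exists2 d, split_at i d & szlenk_iter eps B d f]).
split=> [i f [d _]|d d0]; first exact: szlenk_iter_subset.
have [||f df ndf] := @szlenk_derivation_proper eps _ eps0 d0.
- exact/iter_seq_closed/unit_ball_seq_closed.
- exact: szlenk_iter_subset.
have [|e e0 eP] := @seq_closed_norm_closed (szlenk_iter eps B (OSucc d)) f _ ndf.
  exact/iter_seq_closed/unit_ball_seq_closed.
have [m me] : exists m : nat, m.+1%:R^-1 < e / 2.
  exists (Num.truncn (2 / e)).
  by rewrite -[e / 2]invrK invf_div ltf_pV2 ?posrE ?divr_gt0// truncnS_gt.
have m0 : (0 : R) < m.+1%:R^-1 by rewrite invr_gt0.
have [j fj] := h_dense f m0.
have dP : split_at (j, m) d.
  split=> /= [|g gj]; first by exists f.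
  apply: eP; move: (m.+1%:R^-1) me fj gj => r me fj gj.
  by have := ndist_triangle (h j) f g; rewrite (ndistC (h j)); norm_lra.
exists (j, m); apply/seteqP; split=> [g dg|g [d' d'P]]; first by exists d.
have [dd'|d'd] := ole_total d d'; last by case: (not_lt _ _ _ d'P dP).
exact: szlenk_iter_ole.
Qed.

(** The supremum of the successors of one ordinal for each possible nonempty
    iterate works: a nonempty iterate there would be contained in its own
    derivation. *)
Lemma szlenk_iter_vanishes eps : 0 < eps -> exists d, szlenk_iter eps B d = set0.
Proof.
move=> eps0; have [L [_ LP]] := szlenk_iter_countable eps0.
have /choice[a aP] i : exists d,
    (exists d', szlenk_iter eps B d' = L i) -> szlenk_iter eps B d = L i.
  have [[d dP]|H] := pselect (exists d', szlenk_iter eps B d' = L i).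
    by exists d.
  by exists OZero => /H.
exists (OSup (fun i => OSucc (a i))); set d := OSup _.
apply: contrapT => /eqP/set0P d0.
have [i di] := LP d d0.
have ai : szlenk_iter eps B (a i) = L i by apply: aP; exists d.
have [||f df ndf] := @szlenk_derivation_proper eps _ eps0 d0.
- exact/iter_seq_closed/unit_ball_seq_closed.
- exact: szlenk_iter_subset.
by apply: ndf; rewrite di -ai; have [_ /(_ i I)] := df.
Qed.

End szlenk_derivations.

Lemma is_Szlenk_eps_exists (R : realType) (k : scalar_kind)
    (V : normedModType (scalars R k)) (K : set (dual V)) eps :
  (exists d, szlenk_iter eps K d = set0) -> exists a, is_Szlenk_eps K eps a.
Proof.
move=> [d]; elim/(well_founded_ind olt_wf): d => d IH d0.
have [[b [bd b0]]|H] := pselect (exists b, olt b d /\ szlenk_iter eps K b = set0).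
  exact: (IH b).
exists d; split=> // b b0; have [//|bd] := ole_total d b.
by case: H; exists b.
Qed.

Lemma separable_dense_sequence (R : realType) (k : scalar_kind)
    (V : normedModType (scalars R k)) : separable_space V ->
  exists h : nat -> V, forall x (eta : R), 0 < eta -> exists j, rnorm (x - h j) < eta.
Proof.
move=> [D [/countable_injP[code codeI] /dense_rnormP Dd]].
exists (fun n => xget 0 [set x | D x /\ code x = n]) => x eta eta0.
have [y Dy xy] := Dd x eta eta0; exists (code y).
case: xgetP => [z _ [Dz zy]|/(_ y)[]//].
by rewrite (codeI z y)// inE.
Qed.

(** * Construction of norming towers *)

(** The functionals [g n] may be chosen one at a time from admissible moves, each
    depending on a state: the tower only asks that [g n] annihilate a finite
    biorthogonal system fixed before [g n] is chosen. *)
Lemma norming_tower_exists (R : realType) (k : scalar_kind)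
    (V : normedModType (scalars R k)) (delta : R) (h : nat -> dual V)
    (S : Type) (s0 : S) (move : nat -> S -> dual V -> S -> Prop) :
  0 < delta ->
  (forall n s (sys : seq (V * dual V)), biorthogonal sys ->
    exists g s', [/\ g != 0, sdproj sys g = 0 & move n s g s']) ->
  exists (W : nat -> set V) (e : nat -> V) (g : nat -> dual V) (st : nat -> S),
    [/\ norming_tower delta h W e g, st 0%N = s0
      & forall n, move n (st n) (g n) (st n.+1)].
Proof.
move=> delta0 moveP.
pose sysT := seq (V * dual V).
pose T : Type := {sys : sysT | biorthogonal sys} * S.
pose spec (n : nat) (sys : sysT) (s : S) (sys' : sysT) (s' : S) e g mid :=
  [/\ [/\ exists t, mid = t ++ (e, g) :: sys, exists t, sys' = t ++ mid & biorthogonal mid],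
      [/\ sproj sys e = 0, sdproj sys g = 0 & g e = 1],
      sdproj mid (h n) = h n,
      forall u, sdproj mid u = u -> exists w, [/\ rnorm w <= 1, sproj sys' w = w
        & rnorm u <= (1 + delta) * rnorm (u w)]
    & move n s g s'].
have /choice[next nextP] (p : nat * T) :
    exists q : T * ((V * dual V) * sysT),
    spec p.1 (sval p.2.1) p.2.2 (sval q.1.1) q.1.2 q.2.1.1 q.2.1.2 q.2.2.
  case: p => n [[sys bs] s].
  have [g [s' [g0 sg sgs']]] := moveP n s sys bs.
  have [x gx] := dual_neq0 g0; pose e := x - sproj sys x.
  have se : sproj sys e = 0 by rewrite linearB /= sproj_idem// subrr.
  have ge : g e = 1 by rewrite /e dual_funB gx -sdprojE sg subr0.
  have b1 : biorthogonal ((e, g) :: sys) by [].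
  have [t1 [b2 fh]] := extend_fix_functional (h n) b1.
  have [t2 [b3 nw]] := extend_norming delta0 b2.
  exists ((exist _ _ b3, s'), ((e, g), t1 ++ (e, g) :: sys)).
  by split=> //; split=> //; [exists t1|exists t2].
pose st := fix st n : T :=
  if n is n'.+1 then (next (n', st n')).1 else (exist _ [::] I, s0).
pose sys n := sval (st n).1; pose e n := (next (n, st n)).2.1.1.
pose g n := (next (n, st n)).2.1.2; pose mid n := (next (n, st n)).2.2.
have stP n : spec n (sys n) (st n).2 (sys n.+1) (st n.+1).2 (e n) (g n) (mid n).
  exact: (nextP (n, st n)).
have bsys n : biorthogonal (sys n) by rewrite /sys; case: (st n).1.
have sub m n : (m <= n)%N -> exists t, sys n = t ++ sys m.
  elim: n => [|n IH]; first by rewrite leqn0 => /eqP->; exists [::].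
  rewrite leq_eqVlt => /orP[/eqP->|]; first by exists [::].
  rewrite ltnS => /IH[t tE].
  have [[[t1 E1] [t2 E2] _] _ _ _ _] := stP n.
  exists (t2 ++ t1 ++ (e n, g n) :: t).
  by rewrite E2 E1 tE -!catA.
have gmid n : sdproj (mid n) (g n) = g n.
  have [[[t ->] _ bm] [_ sg ge] _ _ _] := stP n.
  by apply: sdproj_fix_cat => //; rewrite sdproj_cons /= ge scale1r sg addr0.
have mid_sys m n f : sdproj (mid m) f = f -> (m < n)%N -> sdproj (sys n) f = f.
  move=> mf mn; have [t tE] := sub _ _ mn.
  have [[_ [t2 E2] _] _ _ _ _] := stP m.
  rewrite tE E2 catA; apply: sdproj_fix_cat => //.
  by rewrite -catA -E2 -tE.
have sys_mid n f : sdproj (sys n) f = f -> sdproj (mid n) f = f.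
  move=> sf; have [[[t E] _ bm] _ _ _ _] := stP n.
  rewrite E -cat_rcons; apply: sdproj_fix_cat => //.
  by rewrite cat_rcons -E.
exists (fun n => [set w | sproj (sys n) w = w]), e, g, (fun n => (st n).2).
split=> // [|n]; last by have [] := stP n.
split=> [n|n a x y /= sx sy|m n mn w /= sw|n|n w /= sw|n|i n ltin|n c h' h'P].
- by rewrite /= linear0.
- by rewrite sproj_linear sx sy.
- have [t tE] := sub _ _ mn; rewrite tE; apply: sproj_fix_cat => //.
  by rewrite -tE.
- have [[[t E1] [t2 E2] _] [se _ ge] _ _ _] := stP n.
  rewrite /= E2 E1 catA; apply: sproj_fix_cat.
    by rewrite -catA -E1 -E2.
  by rewrite sproj_cons /= ge scale1r se addr0.
- by have [_ [_ sg _] _ _ _] := stP n; rewrite -sw -sdprojE sg.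
- by have [_ [_ _ ge] _ _ _] := stP n.
- have [_ [se _ _] _ _ _] := stP n.
  by rewrite -(mid_sys _ _ _ (gmid i) ltin) sdprojE se dual_fun0.
case: n h'P => [|n] h'P.
  exists 0; rewrite /= linear0 rnorm0 ler01; split=> //.
  case: h'P => [->|[]//]; rewrite big_ord0 subrr !rnorm0.
  by rewrite mulr_ge0 ?rnorm_ge0// addr_ge0 ?ler01 ?(ltW delta0).
have h'mid : sdproj (mid n) h' = h'.
  case: h'P => [->|[j jn ->]]; first by rewrite linear0.
  have hj : sdproj (mid j) (h j) = h j by have [] := stP j.
  move: jn; rewrite ltnS leq_eqVlt => /orP[/eqP<-//|jn].
  by apply: sys_mid; exact: mid_sys hj jn.
have [_ _ _ nw _] := stP n.
have [|w [w1 sw uw]] := nw (\sum_(i < n.+1) c i *: g i - h').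
  rewrite linearB /= h'mid linear_sum; congr (_ - _); apply: eq_bigr => i _.
  rewrite linearZ /=; congr (_ *: _); have := ltn_ord i.
  rewrite ltnS leq_eqVlt => /orP[/eqP->//|ltin].
  by apply: sys_mid; exact: mid_sys (gmid i) ltin.
by exists w.
Qed.

(** * Trees of functionals *)

Lemma schedule (T : countType) (t0 : T) : exists task : nat -> T,
  forall t N, exists2 n, (N <= n)%N & task n = t.
Proof.
exists (fun n => if (unpickle n : option (T * nat)) is Some (t, _) then t else t0) => t N.
have [j Nj] : exists j : nat, (N <= pickle (t, j))%N.
  apply: contrapT => H.
  have : uniq [seq pickle (t, j) | j <- iota 0 N.+1].
    by rewrite map_inj_uniq ?iota_uniq// => i j /(pcan_inj pickleK)[].
  move=> /uniq_leq_size => /(_ (iota 0 N)); rewrite size_map !size_iota ltnn => le.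
  suff : false by []. apply: le => _ /mapP[j _ ->]; rewrite mem_iota /= add0n ltnNge.
  by apply/negP => Nj; apply: H; exists j.
by exists (pickle (t, j)) => //; rewrite pickleK.
Qed.

Lemma posrat_sequence (R : realType) : exists q : nat -> R,
  (forall m, 0 < q m) /\
  forall a b : R, 0 < a -> a < b -> exists2 m, a < q m & q m < b.
Proof.
pose q n : R := if (unpickle n : option rat) is Some r then
  (if 0 < ratr r :> R then ratr r else 1) else 1.
exists q; split=> [m|a b a0 ab].
  by rewrite /q; case: unpickle => [r|//]; case: ifP.
have [r] := rat_in_itvoo ab; rewrite in_itv /= => /andP[ar rb].
by exists (pickle r); rewrite /q pickleK (lt_trans a0 ar).
Qed.

Section tree.
Context {R : realType} {k : scalar_kind}.
Local Notation K := (scalars R k).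
Context {V : normedModType K}.
Local Notation B := (unit_ball (dual V)).

(** A node [(m, f, p)] carries a level [m], a functional [f] of the ball and
    the sum [p] of the tower functionals along its branch; [p] differs from [f] by
    the functional at the root and by the errors of the corrections that made the
    increments annihilate the systems built so far. *)
Local Notation node := (nat * dual V * dual V)%type.
(** [inl (m, i)] asks for a root in [L m i], and [inr (j, i)] for a child of the
    [j]-th node in [L m i], where [m] is the level of that node. *)
Local Notation task := ((nat * (nat * nat)) + (nat * (nat * nat)))%type.

Context (q : nat -> R) (L : nat -> nat * nat -> set (dual V)).

Definition fulfils (t : task) (s : seq node) (g : dual V) (x : node) : Prop :=
  match t with
  | inl (m, i) => L m i !=set0 -> [/\ x.1.1 = m, L m i x.1.2 & x.2 = 0]
  | inr (j, i) => forall y, (j < size s)%N -> nth (0%N, 0, 0) s j = y ->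
      szlenk_derivation (q y.1.1) (L y.1.1 i) y.1.2 ->
      [/\ x.1.1 = y.1.1, L y.1.1 i x.1.2, x.2 = y.2 + g, rnorm g <= 3
        & 3 / 8 * q y.1.1 < rnorm g]
  end.

(** The error allowed at step [n] keeps [p] within [2 - 2^-n] of [f] along every
    branch, the distance at the root being at most one. *)
Definition sound (n : nat) (s : seq node) (g : dual V) (x : node) : Prop :=
  rnorm x.1.2 <= 1 /\
  (x.2 = 0 \/ exists2 j, (j < size s)%N & let y := nth (0%N, 0, 0) s j in
    x.2 = y.2 + g /\ ndist x.2 x.1.2 <= ndist y.2 y.1.2 + 2^-1 ^+ n).

Definition tree_step (tasks : nat -> task) (n : nat) (s : seq node)
    (g : dual V) (s' : seq node) : Prop :=
  exists x, [/\ s' = rcons s x, fulfils (tasks n) s g x & sound n s g x].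

Hypothesis q_gt0 : forall m, 0 < q m.
Hypothesis L_ball : forall m i, L m i `<=` B.

(** Apply [szlenk_derivation_far] with a weak* tolerance so small that correcting
    [f' - f] by [sdproj sys] costs at most [2^-n] and an eighth of [eps]. *)
Lemma child_exists n (s : seq node) (sys : seq (V * dual V)) (j : nat) i :
  let y := nth (0%N, 0, 0) s j in
  biorthogonal sys -> (j < size s)%N ->
  szlenk_derivation (q y.1.1) (L y.1.1 i) y.1.2 ->
  exists g x, [/\ g != 0, sdproj sys g = 0, fulfils (inr (j, i)) s g x & sound n s g x].
Proof.
move=> y bs js yL; set eps := q y.1.1 in yL *; set f := y.1.2 in yL *.
have eps0 : 0 < eps by exact: q_gt0.
have Lf : L y.1.1 i f by case: yL.
pose tol := Num.min (2^-1 ^+ n) (eps / 8).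
have tol0 : 0 < tol by rewrite lt_min exprn_gt0 ?invr_gt0// divr_gt0.
have [tn te] : tol <= 2^-1 ^+ n /\ tol <= eps / 8 by rewrite !ge_min !lexx ?orbT.
have n1 : (2^-1 : R) ^+ n <= 1.
  by rewrite exprn_ile1 ?invr_ge0// invf_le1// ler1n.
pose M := \sum_(p <- sys) rnorm p.2.
have M0 : 0 <= M by apply: sumr_ge0 => p _; exact: rnorm_ge0.
have eta0 : 0 < tol / (M + 1) by rewrite divr_gt0// ltr_wpDl.
have [f' [Lf' f'f f'far]] := szlenk_derivation_far f (map fst sys) eta0 yL.
pose r := sdproj sys (f' - f); pose g := (f' - f) - r.
have rtol : rnorm r <= tol.
  apply: le_trans (@sdproj_small _ _ _ sys (f' - f) _ (ltW eta0) _) _.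
    by move=> v vs; exact: ltW (f'f v vs).
  by rewrite -/M -mulrA ler_piMr ?(ltW tol0)// mulrC ler_pdivrMr ?ltr_wpDl// mul1r lerDl.
have sg : sdproj sys g = 0 by rewrite linearB /= sdproj_idem// subrr.
have f1 : rnorm f <= 1 by apply/unit_ballE/(L_ball Lf).
have f'1 : rnorm f' <= 1 by apply/unit_ballE/(L_ball Lf').
have gfar : 3 / 8 * eps < rnorm g.
  have gr : ndist f' f - rnorm r <= rnorm g by exact: rnormB_ge.
  by move: rtol te f'far; norm_lra.
have g3 : rnorm g <= 3.
  have gr : rnorm g <= ndist f' f + rnorm r.
    by rewrite -(rnormN r); exact: rnormD.
  have ff : ndist f' f <= rnorm f' + rnorm f by rewrite -(rnormN f); exact: rnormD.
  by move: rtol f1 f'1 tn n1; norm_lra.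
have gpos : 0 < rnorm g by rewrite (lt_trans _ gfar)// mulr_gt0// divr_gt0.
exists g, (y.1.1, f', y.2 + g); split=> //.
- by rewrite -rnorm_gt0.
- by move=> z _ <- _; split.
- split=> //; right; exists j => //=; split=> //.
  have -> : ndist (y.2 + g) f' = ndist y.2 (f + r).
    rewrite /ndist /g; congr rnorm; rewrite -addrA; congr (_ + _).
    by rewrite addrAC (addrAC f') subrr add0r opprD.
  apply: (le_trans (ndist_triangle f _ _)); rewrite lerD2l.
  by rewrite /ndist opprD addrA subrr sub0r rnormN (le_trans rtol).
Qed.

(** A step whose task is void appends a trivial node with an arbitrary
    annihilating functional, which exists as the space has infinite dimension. *)
Lemma tree_step_exists (tasks : nat -> task) : ~ finite_dimensional V ->
  forall n s (sys : seq (V * dual V)), biorthogonal sys ->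
  exists g s', [/\ g != 0, sdproj sys g = 0 & tree_step tasks n s g s'].
Proof.
move=> nfd n s sys bs.
have [g g1 sg] := annihilating_functional nfd bs.
have g0 : g != 0 by rewrite -rnorm_gt0 g1 ltr01.
have root x : fulfils (tasks n) s g x -> rnorm x.1.2 <= 1 -> x.2 = 0 ->
    exists g s', [/\ g != 0, sdproj sys g = 0 & tree_step tasks n s g s'].
  move=> fx x1 x0; exists g, (rcons s x); split=> //.
  by exists x; split=> //; split=> //; left.
have trivial_node : fulfils (tasks n) s g (0%N, 0, 0) ->
    exists g s', [/\ g != 0, sdproj sys g = 0 & tree_step tasks n s g s'].
  by move=> /root; apply=> //=; rewrite rnorm0 ler01.
case E : (tasks n) root trivial_node => [[m i]|[j i]] root trivial_node.
  have [[f Lf]|L0] := pselect (L m i !=set0); last by apply: trivial_node => /L0.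
  apply: (root (m, f, 0)) => //=.
  by apply/unit_ballE; exact: L_ball Lf.
pose y := nth (0%N, 0, 0) s j.
have [[js yL]|H] := pselect ((j < size s)%N /\
    szlenk_derivation (q y.1.1) (L y.1.1 i) y.1.2); last first.
  by apply: trivial_node => z js zE zL; case: H; rewrite /y zE.
have [g' [x [g'0 sg' fx sx]]] := child_exists n bs js yL.
exists g', (rcons s x); split=> //; exists x; split=> //.
by rewrite E.
Qed.

(** ** The nodes of a completed tree *)

Context (tasks : nat -> task) (st : nat -> seq node) (g : nat -> dual V).
Hypothesis tasks_recur : forall t N, exists2 n, (N <= n)%N & tasks n = t.
Hypothesis st0 : st 0%N = [::].
Hypothesis stP : forall n, tree_step tasks n (st n) (g n) (st n.+1).

Let x n : node := nth (0%N, 0, 0) (st n.+1) n.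

Lemma tree_size n : size (st n) = n.
Proof.
elim: n => [|n IH]; first by rewrite st0.
by have [y [-> _ _]] := stP n; rewrite size_rcons IH.
Qed.

Lemma tree_nth n j : (j < n)%N -> nth (0%N, 0, 0) (st n) j = x j.
Proof.
elim: n => [//|n IH]; rewrite ltnS leq_eqVlt => /orP[/eqP->//|jn].
have [y [-> _ _]] := stP n.
by rewrite nth_rcons tree_size jn IH.
Qed.

Lemma tree_fulfils n : fulfils (tasks n) (st n) (g n) (x n).
Proof.
have [y [E fy _]] := stP n.
by rewrite /x E nth_rcons tree_size ltnn eqxx.
Qed.

Lemma tree_sound n : rnorm (x n).1.2 <= 1 /\ ((x n).2 = 0 \/
  exists2 j, (j < n)%N & (x n).2 = (x j).2 + g n /\
    ndist (x n).2 (x n).1.2 <= ndist (x j).2 (x j).1.2 + 2^-1 ^+ n).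
Proof.
have [y [E _ [y1 sy]]] := stP n.
have -> : x n = y by rewrite /x E nth_rcons tree_size ltnn eqxx.
split=> //; case: sy => [|[j]]; [by left|rewrite tree_size => jn jP].
by right; exists j => //; rewrite -(tree_nth jn).
Qed.

Lemma tree_root m i : L m i !=set0 ->
  exists n, [/\ (x n).1.1 = m, L m i (x n).1.2 & (x n).2 = 0].
Proof.
move=> L0; have [n _ nt] := tasks_recur (inl (m, i)) 0%N; exists n.
by have := tree_fulfils n; rewrite nt; apply.
Qed.

Lemma tree_child j i N :
  szlenk_derivation (q (x j).1.1) (L (x j).1.1 i) (x j).1.2 ->
  exists n, [/\ (N <= n)%N, (x n).1.1 = (x j).1.1, L (x j).1.1 i (x n).1.2,
      (x n).2 = (x j).2 + g n
    & rnorm (g n) <= 3 /\ 3 / 8 * q (x j).1.1 < rnorm (g n)].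
Proof.
move=> jL; have [n Nn nt] := tasks_recur (inr (j, i)) (maxn N j.+1).
have jn : (j < n)%N by rewrite (leq_trans _ Nn)// leq_maxr.
have := tree_fulfils n; rewrite nt => /(_ (x j)).
rewrite tree_size tree_nth// => /(_ jn erefl jL)[h1 h2 h3 h4 h5].
by exists n; split=> //; rewrite (leq_trans _ Nn)// leq_maxl.
Qed.

Lemma tree_norm n : rnorm (x n).2 <= 3.
Proof.
have dist_le m : ndist (x m).2 (x m).1.2 <= 2 - 2^-1 ^+ m.
  elim/ltn_ind: m => m IH.
  have [f1 [p0|[j jm [_ pm]]]] := tree_sound m.
    rewrite p0 ndistC ndistx0 (le_trans f1)// lerBrDr.
    have : (2^-1 : R) ^+ m <= 1 by rewrite exprn_ile1 ?invr_ge0// invf_le1// ler1n.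
    by lra.
  apply: le_trans pm _; apply: (le_trans (lerD (IH j jm) (lexx _))).
  have : (2^-1 : R) ^+ m <= 2^-1 ^+ j.+1.
    by rewrite ler_wiXn2l ?invr_ge0// invf_le1// ler1n.
  by rewrite exprS; lra.
have [f1 _] := tree_sound n.
have := rnorm_le_ndist (x n).1.2 (x n).2; have := dist_le n.
have : 0 <= (2^-1 : R) ^+ n by rewrite exprn_ge0 ?invr_ge0.
by move: f1; norm_lra.
Qed.

Lemma tree_kernel n z : (forall i, g i z = 0) -> (x n).2 z = 0.
Proof.
move=> gz; elim/ltn_ind: n => n IH.
have [_ [->//|[j jn [-> _]]]] := tree_sound n.
by rewrite -[LHS]/((x j).2 z + g n z) IH// gz addr0.
Qed.

End tree.

(** * Comparison of the Szlenk indices *)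

Lemma szlenk_iter_eps_le (R : realType) (k : scalar_kind)
    (V : normedModType (scalars R k)) (L : set (dual V)) (eps eps' : R) d :
  eps <= eps' -> szlenk_iter eps' L d `<=` szlenk_iter eps L d.
Proof.
move=> ee; elim: d => [//|d IH|A u IH] f /=; last first.
  by move=> [Lf fu]; split=> // i _; apply: IH; exact: fu.
move=> /szlenk_derivationP[/IH df fd]; apply/szlenk_derivationP; split=> //.
move=> vs eta /(fd vs)[g1 [g2 [[/IH g1d /IH g2d] g1f g2f g12]]].
by exists g1, g2; split=> //; exact: le_lt_trans ee g12.
Qed.

Section quotient_szlenk.
Context {R : realType} {k : scalar_kind}.
Local Notation K := (scalars R k).
Context {V : normedModType K} (Z : closed_subspace V).
Local Notation Q := (quot_space Z).

Lemma quot_pull_ndist (phi psi : dual Q) :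
  ndist (quot_pull phi) (quot_pull psi) = ndist phi psi.
Proof. by rewrite /ndist -quot_pullB quot_pull_norm. Qed.

(** Pulling back is isometric, and evaluating a pull-back at [v] is evaluating the
    functional at the class of [v]. *)
Lemma szlenk_iter_pull (eps : R) d (phi : dual Q) :
  szlenk_iter eps (unit_ball (dual Q)) d phi ->
  szlenk_iter eps (unit_ball (dual V)) d (quot_pull phi).
Proof.
elim: d phi => [|d IH|A u IH] phi /=.
- by move=> /unit_ballE phi1; apply/unit_ballE; rewrite quot_pull_norm.
- move=> /szlenk_derivationP[/IH dphi phid]; apply/szlenk_derivationP; split=> //.
  move=> vs eta /(phid (map (quot_map Z) vs)).
  move=> [g1 [g2 [[/IH g1d /IH g2d] g1f g2f g12]]].
  exists (quot_pull g1), (quot_pull g2); split=> //; last by rewrite quot_pull_ndist.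
    by move=> v vin; rewrite !quot_pullE; apply: g1f; exact: map_f.
  by move=> v vin; rewrite !quot_pullE; apply: g2f; exact: map_f.
- move=> [/unit_ballE phi1 phiu]; split.
    by apply/unit_ballE; rewrite quot_pull_norm.
  by move=> i _; apply: IH; exact: phiu.
Qed.

End quotient_szlenk.

Section tree_szlenk.
Context {R : realType} {k : scalar_kind}.
Local Notation K := (scalars R k).
Context {V : normedModType K} (g : nat -> dual V).
Local Notation Z := (common_kernel g).
Local Notation Q := (quot_space Z).
Local Notation B := (unit_ball (dual V)).

Context (q : nat -> R) (L : nat -> nat * nat -> set (dual V)).
Context (x : nat -> nat * dual V * dual V).
Hypothesis g_null : forall (M : R) (y : V) (e : R), 0 < e ->
  exists N, forall n, (N <= n)%N -> rnorm (g n) <= M -> rnorm (g n y) < e.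
Hypothesis L_iter : forall m d, szlenk_iter (q m) B d !=set0 ->
  exists i, szlenk_iter (q m) B d = L m i.
Hypothesis x_norm : forall n, rnorm (x n).2 <= 3.
Hypothesis x_kernel : forall n z, (forall i, g i z = 0) -> (x n).2 z = 0.
Hypothesis x_root : forall m i, L m i !=set0 ->
  exists n, [/\ (x n).1.1 = m, L m i (x n).1.2 & (x n).2 = 0].
Hypothesis x_child : forall j i N,
  szlenk_derivation (q (x j).1.1) (L (x j).1.1 i) (x j).1.2 ->
  exists n, [/\ (N <= n)%N, (x n).1.1 = (x j).1.1, L (x j).1.1 i (x n).1.2,
      (x n).2 = (x j).2 + g n
    & rnorm (g n) <= 3 /\ 3 / 8 * q (x j).1.1 < rnorm (g n)].

Lemma node_functionals : exists psi : nat -> dual Q,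
  forall n, quot_pull (psi n) = toK 3^-1 *: (x n).2.
Proof.
have /choice[psi psiP] n : exists psi : dual Q,
    forall y, psi (quot_map Z y) = (toK 3^-1 *: (x n).2) y.
  apply: quot_push => z /common_kernelP gz.
  by rewrite -[LHS]/(toK 3^-1 * (x n).2 z) x_kernel// mulr0.
by exists psi => n; apply: dual_eqP => y; rewrite quot_pullE psiP.
Qed.

Lemma null_on_list (vs : seq V) (M e : R) : 0 < e ->
  exists N, forall n, (N <= n)%N -> rnorm (g n) <= M ->
    forall v, v \in vs -> rnorm (g n v) < e.
Proof.
move=> e0; elim: vs => [|v vs [N NP]]; first by exists 0%N.
have [N' NP'] := g_null M v e0.
exists (maxn N N') => n; rewrite geq_max => /andP[Nn N'n] gM w.
rewrite inE => /orP[/eqP->|]; first exact: NP'.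
exact: NP.
Qed.

(** The functionals of the children of a node converge weak* to its own, at
    distance at least a third of the norm of the increment. *)
Lemma node_szlenk (psi : nat -> dual Q) d n :
  (forall n, quot_pull (psi n) = toK 3^-1 *: (x n).2) ->
  szlenk_iter (q (x n).1.1) B d (x n).1.2 ->
  szlenk_iter (q (x n).1.1 / 8) (unit_ball (dual Q)) d (psi n).
Proof.
move=> psiP.
have t0 : (0 : R) <= 3^-1 by rewrite invr_ge0.
have psi1 j : unit_ball (dual Q) (psi j).
  apply/unit_ballE; rewrite -quot_pull_norm psiP rnormZ rnorm_toK ger0_norm//.
  by rewrite ler_pdivrMl// mulr1.
elim: d n => [|d IH|A u IH] n /=; first by [].
  move=> nd; have dn : szlenk_iter (q (x n).1.1) B d (x n).1.2 by case: nd.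
  have [|i Li] := @L_iter (x n).1.1 d; first by exists (x n).1.2.
  apply/szlenk_derivationP; split; first exact: IH.
  move=> vs eta eta0.
  have [N NP] := null_on_list (map repr vs) 3 eta0.
  have [|j [Nj jm jL jp [j3 jfar]]] := @x_child n i N; first by rewrite -Li.
  have diff y : psi j (quot_map Z y) - psi n (quot_map Z y) = toK 3^-1 * g j y.
    rewrite -!quot_pullE !psiP jp.
    rewrite -[LHS]/(toK 3^-1 * ((x n).2 y + g j y) - toK 3^-1 * (x n).2 y).
    by rewrite -mulrBr addrAC subrr add0r.
  exists (psi j), (psi n); split.
  - split; last exact: IH.
    by rewrite -jm; apply: IH; rewrite jm Li.
  - move=> v vin; have [y yE] : exists y, quot_map Z y = v /\ y \in map repr vs.
      by exists (repr v); split; [rewrite /quot_map reprK|exact: map_f].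
    have [<- yvs] := yE; rewrite /ndist diff rnormM rnorm_toK ger0_norm//.
    apply: le_lt_trans (NP j Nj j3 y yvs).
    by rewrite ler_piMl ?rnorm_ge0// invf_le1// ler1n.
  - by move=> v _; rewrite ndistxx.
  - rewrite -quot_pull_ndist /ndist !psiP -scalerBr jp addrAC subrr add0r.
    rewrite rnormZ rnorm_toK ger0_norm// ltr_pdivlMl//.
    by rewrite (_ : 3 * _ = 3 / 8 * q (x n).1.1)//; field.
move=> [_ nu]; split=> // i _; apply: IH; exact: nu.
Qed.

Lemma tree_szlenk m d : szlenk_iter (q m) B d !=set0 ->
  szlenk_iter (q m / 8) (unit_ball (dual Q)) d !=set0.
Proof.
move=> d0; have [i di] := L_iter d0.
have [|n [nm nL _]] := @x_root m i; first by rewrite -di.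
have [psi psiP] := node_functionals; exists (psi n).
by rewrite -nm; apply: node_szlenk => //; rewrite nm di.
Qed.

End tree_szlenk.

Theorem theorem2 (R : realType) (k : scalar_kind)
    (X : completeNormedModType (scalars R k)) (delta : R)
    (X_infinite : ~ finite_dimensional X) (X_dual : separable_space (dual X))
    (delta_gt0 : 0 < delta) :
  exists Z : closed_subspace X,
    [/\ exists e : nat -> quot_space Z,
          [/\ schauder_basis e, shrinking e
            & (basis_constant e <= (1 + delta)%:E)%E],
        forall eps : R, 0 < eps ->
          exists a b : ord,
            [/\ is_Szlenk_eps (unit_ball (dual X)) eps a,
                is_Szlenk_eps (unit_ball (dual (quot_space Z))) (eps / 9) b
              & ole a b]
      & exists a : ord,
          is_Szlenk (unit_ball (dual X)) a /\
          is_Szlenk (unit_ball (dual (quot_space Z))) a].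
Proof.
have [h hd] := separable_dense_sequence X_dual.
have [q [q0 qd]] := posrat_sequence R.
have /choice[L LP] m : exists L : nat * nat -> set (dual X),
    (forall i, L i `<=` unit_ball (dual X)) /\
    forall d, szlenk_iter (q m) (unit_ball (dual X)) d !=set0 ->
      exists i, szlenk_iter (q m) (unit_ball (dual X)) d = L i.
  exact: szlenk_iter_countable hd _ (q0 m).
have L_ball m i : L m i `<=` unit_ball (dual X) by have [+ _] := LP m; apply.
have [task taskP] := @schedule ((nat * (nat * nat)) + (nat * (nat * nat)))%type
  (inl (0%N, (0%N, 0%N))).
have [W [e [g [st [tower st0 stP]]]]] := norming_tower_exists h [::] delta_gt0
  (tree_step_exists q0 L_ball task X_infinite).
pose Z := common_kernel g; exists Z.
have szX (eps : R) : 0 < eps -> exists a, is_Szlenk_eps (unit_ball (dual X)) eps a.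
  by move=> eps0; apply: is_Szlenk_eps_exists; exact: szlenk_iter_vanishes hd _ eps0.
have pull0 (eps : R) d : szlenk_iter eps (unit_ball (dual X)) d = set0 ->
    szlenk_iter eps (unit_ball (dual (quot_space Z))) d = set0.
  move=> d0; rewrite -subset0 => phi /szlenk_iter_pull.
  by rewrite d0.
have szQ (eps : R) : 0 < eps ->
    exists a, is_Szlenk_eps (unit_ball (dual (quot_space Z))) eps a.
  move=> /szX[a [a0 _]]; apply: is_Szlenk_eps_exists; exists a.
  exact: pull0.
have lower (eps : R) d : 0 < eps ->
    szlenk_iter (eps / 9) (unit_ball (dual (quot_space Z))) d = set0 ->
    szlenk_iter eps (unit_ball (dual X)) d = set0.
  move=> eps0 d0; apply: contrapT => /eqP/set0P dX.
  (* The lower bound makes [q m / 8] at least [eps / 9]. *)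
  have [m m1 m2] : exists2 m, 8 / 9 * eps < q m & q m < eps.
    by apply: qd; lra.
  have : szlenk_iter (q m / 8) (unit_ball (dual (quot_space Z))) d !=set0.
    apply: (@tree_szlenk _ _ _ g q L
      (fun n => nth (0%N, 0, 0) (st n.+1) n)).
    - exact: tower_null_functionals delta_gt0 hd tower.
    - by move=> n c; have [_ +] := LP n; apply.
    - exact: tree_norm st0 stP.
    - exact: tree_kernel st0 stP.
    - exact: tree_root taskP st0 stP.
    - exact: tree_child taskP st0 stP.
    - have [f df] := dX; exists f; apply: szlenk_iter_eps_le df; exact: ltW.
  move=> [psi psid]; have : set0 psi; last by [].
  rewrite -d0; apply: szlenk_iter_eps_le psid; lra.
split.
- exists (fun n => quot_map Z (e n)).
  exact: (quotient_shrinking_basis delta_gt0 hd tower).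
- move=> eps eps0; have [a aP] := szX eps eps0.
  have [|b bP] := szQ (eps / 9); first by rewrite divr_gt0.
  exists a, b; split=> //; have [_ amin] := aP; have [b0 _] := bP.
  by apply: amin; exact: lower.
- have [F FP] := choice (fun eps : {posnum R} => szX eps%:num (gt0 eps)).
  have [G GP] := choice (fun eps : {posnum R} => szQ eps%:num (gt0 eps)).
  exists (OSup F); split; first by exists F; split=> //; split; exact: ole_refl.
  exists G; split=> //; split=> eps /=.
    apply: (@ole_OSup _ _ (eps%:num / 9)%:pos); have [_ Fmin] := FP eps.
    by apply: Fmin; apply: lower => //; have [] := GP (eps%:num / 9)%:pos.
  apply: (@ole_OSup _ _ eps); have [_ Gmin] := GP eps.
  by apply: Gmin; apply: pull0; have [] := FP eps.
Qed.
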